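(* Let $\beta>2$, $\kappa=\beta/2$, and let $f:[0,\infty)\to[0,\infty]$ be a measurable function with compact support such that for some $\varrho>0$: $f(r)=r^{-\beta}$ for $0\le r\le\varrho$, $\sup_{r\ge\varrho}f(r)<\infty$, and $\int_\varrho^\infty r f(r)\,dr<\infty$. For $\lambda>0$ let $\tilde\Phi_\lambda=\{(x_i,\mathbf{p}_i)\}$ be an independently marked Poisson point process on $\mathbb{R}^2$ of intensity $\lambda$ with marks of distribution $F$ on $(0,\infty)$, $\int_0^\infty pF(dp)<\infty$, and let $\mathcal{I}_\lambda(f;z)=\sum_{(x_i,\mathbf{p}_i)\in\tilde\Phi_\lambda}\mathbf{p}_if(\|x_i-z\|)$. Let $\{g_{z\bar z}:z,\bar z\in\mathbb{Z}^2\}$ be positive i.i.d. random variables and $\{W_z:z\in\mathbb{Z}^2\}$ non-negative i.i.d. random variables, these families being independent of each other and of $\tilde\Phi_\lambda$ for all $\lambda$. Define $S_\lambda(z,\bar z)=\frac{g_{z\bar z}/f(1)}{W_{\bar z}+\mathcal{I}_\lambda(f;\bar z)}$. For a threshold $\tau_\lambda=c\lambda^{-\kappa}$ ($c>0$), say $z$ is connected to $\bar z$ if $S_\lambda(z,\bar z)\ge\tau_\lambda$, and form the random graph on $\mathbb{Z}^2$ with an edge between $z$ and $\bar z$ if and only if $z,\bar z$ are nearest neighbours in $\mathbb{Z}^2$ and are connected to each other. Let $\mathcal{C}_0^\lambda$ be the connected component of this graph containing $0$ and $|\mathcal{C}_0^\lambda|$ its number of sites. Then there exist positive constants $\lambda_0,c_0$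 such that for any $\lambda\ge\lambda_0$ and $c\in(0,c_0]$, $\mathbb{P}(|\mathcal{C}_0^\lambda|=\infty)>0$.
   Context: An independently marked Poisson point process of intensity $\lambda$ on $\mathbb{R}^2$ is a marked point process $\{(x_i,\mathbf{p}_i)\}$ where $\{x_i\}$ is a homogeneous Poisson point process of intensity $\lambda$ with respect to Lebesgue measure, and the marks $\mathbf{p}_i\in(0,\infty)$ are i.i.d. with distribution $F$ and independent of $\{x_i\}$. *)

(* Defs.v *)
From HB Require Import structures.
From mathcomp Require Import all_boot all_order all_algebra.
From mathcomp Require Import all_classical all_reals all_analysis measurable_realfun.
From Stdlib Require Import Relations.
Set Implicit Arguments. Unset Strict Implicit. Unset Printing Implicit Defensive.
Import Order.TTheory GRing.Theory Num.Theory.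
Import numFieldNormedType.Exports.
Local Open Scope classical_set_scope.
Local Open Scope ring_scope.

Definition Z2 := (int * int)%type.

Section Defs.
Context {R : realType}.

Definition mpoint := ((R * R) * R)%type.

Definition dist2 (x : R * R) (z : Z2) : R :=
  Num.sqrt ((x.1 - z.1%:~R) ^+ 2 + (x.2 - z.2%:~R) ^+ 2).

(* Poisson probability mass function with mean m >= 0 (0^0 = 1). *)
Definition pois_pmf (m : R) (k : nat) : R := m ^+ k / k`!%:R * expR (- m).

Definition npoints (S : set mpoint) : \bar R := (\esum_(x in S) 1)%E.

Definition intensity (lam : R) (F : set R -> \bar R) (D : set mpoint) : \bar R :=
  (lam%:E * ((@lebesgue_measure R \x @lebesgue_measure R) \x F) D)%E.

Definition interference (f : R -> \bar R) (Phi : set mpoint) (z : Z2) : \bar R :=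
  (\esum_(xp in Phi) (xp.2%:E * f (dist2 xp.1 z)))%E.

(* S(z, zbar) = (g_{z zbar} / f(1)) / (W_zbar + I(f; zbar)), in [0,+oo]
   with the extended-real conventions 1/0 = +oo, 1/+oo = 0. *)
Definition SINR (f : R -> \bar R) (gzz : R) (Wz : R) (I : \bar R) : \bar R :=
  ((gzz%:E * (f 1%R)^-1) * (Wz%:E + I)^-1)%E.

(* Joint law of (Phi, g, W) on a probability space: Phi is an independently
   marked Poisson point process on R^2 of intensity lam with mark law F
   (marks in (0,oo)), i.e. a Poisson process on R^2 x (0,oo) with intensity
   measure lam Leb (x) F; {g_{z zbar}} are i.i.d. with law Lg, {W_z} are
   i.i.d. with law LW, and the three families are mutually independent.
   This is expressed by the product formula for the probability of every
   finite-dimensional cylinder event (distinct indices, disjoint sets of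
   finite intensity for the counts), which characterizes the joint law. *)
Definition marked_model d (T : measurableType d) (P : probability T R)
    (lam : R) (F Lg LW : probability R R)
    (Phi : T -> set mpoint) (g : Z2 -> Z2 -> T -> R) (W : Z2 -> T -> R) : Prop :=
  [/\ (forall w, Phi w `<=` [set xp | 0 < xp.2]),
      (forall z z' B, measurable B -> measurable (g z z' @^-1` B)),
      (forall z B, measurable B -> measurable (W z @^-1` B)),
      (forall D (k : nat), measurable D ->
          measurable [set w | npoints (Phi w `&` D) = k%:R%:E]) &
      (forall (n m l : nat) (e : 'I_n -> Z2 * Z2) (B : 'I_n -> set R)
              (u : 'I_m -> Z2) (C : 'I_m -> set R)
              (D : 'I_l -> set mpoint) (k : 'I_l -> nat),
          injective e -> injective u ->
          (forall i, measurable (B i)) -> (forall j, measurable (C j)) ->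
          (forall i, measurable (D i)) ->
          (forall i, (intensity lam F (D i) < +oo)%E) ->
          (forall i i', i != i' -> D i `&` D i' = set0) ->
          P (\bigcap_(i in [set: 'I_n]) (g (e i).1 (e i).2 @^-1` B i)
             `&` \bigcap_(j in [set: 'I_m]) (W (u j) @^-1` C j)
             `&` \bigcap_(i in [set: 'I_l])
                    [set w | npoints (Phi w `&` D i) = (k i)%:R%:E])
          = ((\prod_(i < n) Lg (B i)) * (\prod_(j < m) LW (C j))
             * \prod_(i < l) (pois_pmf (fine (intensity lam F (D i))) (k i))%:E)%E)].

End Defs.

Definition nearest (z z' : Z2) : bool :=
  (`|z.1 - z'.1|%N + `|z.2 - z'.2|%N == 1)%N.

Definition edge (conn : Z2 -> Z2 -> Prop) (z z' : Z2) : Prop :=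
  nearest z z' /\ conn z z' /\ conn z' z.

Definition cluster0 (conn : Z2 -> Z2 -> Prop) : set Z2 :=
  [set z | clos_refl_trans Z2 (edge conn) (0%R, 0%R) z].

(* Main.v *)
Require Import Defs.
From Stdlib Require Import Relations.
From HB Require Import structures.
From mathcomp Require Import all_boot all_order all_algebra.
From mathcomp Require Import all_classical all_reals all_analysis measurable_realfun.
From mathcomp Require Import zify lra ring.
Set Implicit Arguments. Unset Strict Implicit. Unset Printing Implicit Defensive.
Import Order.TTheory GRing.Theory Num.Theory.
Import numFieldNormedType.Exports.
Local Open Scope classical_set_scope.
Local Open Scope ring_scope.

(* Call a site bad when the noise plus interference it receives exceeds a constant
   multiple of [lam `^ (beta / 2)], or when one of the four fading variables charged
   to it is too small; neighbouring good sites are then connected both ways.  The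
   indicator of a bad site is dominated by a linear combination [site_excess] of
   indicators of cylinder events, whose mean is small uniformly in [lam >= 1]: an
   interferer within distance [delta * lam `^ (-1/2)] is unlikely, and the power law
   summed over dyadic radii beyond that distance has mean of order
   [lam `^ (beta / 2)].  Since [f] has compact support the excesses of sites far
   apart are independent, so the expectation of their product factorises and
   Markov's inequality makes [k] given sites simultaneously bad with probability
   at most [eta ^+ k].  A Peierls argument concludes: a finite cluster of good sites
   is surrounded by a star-connected contour of bad sites. *)

(** * Contours around finite clusters *)

Definition star (z z' : Z2) : bool :=
  (`|z.1 - z'.1| <= 1)%N && (`|z.2 - z'.2| <= 1)%N.

(* In each unit square the sites off [C] adjacent to [C] are bad, hence pairwise
   related by [r]: so [C]-boundary edges selected by [r] number evenly. *)
Lemma square_parity (a b c d : bool) (ga gb gc gd ra rb rc rd : bool) :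
  (a && ~~ b ==> ~~ gb) -> (b && ~~ a ==> ~~ ga) ->
  (b && ~~ c ==> ~~ gc) -> (c && ~~ b ==> ~~ gb) ->
  (c && ~~ d ==> ~~ gd) -> (d && ~~ c ==> ~~ gc) ->
  (d && ~~ a ==> ~~ ga) -> (a && ~~ d ==> ~~ gd) ->
  (~~ ga && ~~ gb ==> (ra == rb)) -> (~~ gb && ~~ gc ==> (rb == rc)) ->
  (~~ gc && ~~ gd ==> (rc == rd)) -> (~~ gd && ~~ ga ==> (rd == ra)) ->
  (~~ ga && ~~ gc ==> (ra == rc)) -> (~~ gb && ~~ gd ==> (rb == rd)) ->
  let h u v ru rv := [|| [&& u, ~~ v & rv] | [&& v, ~~ u & ru]] in
  h a b ra rb (+) h b c rb rc (+) h d c rd rc (+) h a d ra rd = false.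
Proof.
by case: a; case: b; case: c; case: d => //=; case: ga; case: gb => //=;
  case: gc; case: gd => //=; case: ra; case: rb; case: rc; case: rd.
Qed.

Section Contour.
Variables (good C : pred Z2) (N : nat).
Hypothesis C0 : C (0, 0).
Hypothesis C_closed : forall u v, nearest u v -> C u -> good v -> C v.
(** Connectedness is phrased through two-valued functions because it is applied to a single one, the
    potential [D] constructed below. *)
Hypothesis C_conn : forall D : pred Z2,
  (forall u v, nearest u v -> C u -> C v -> D u = D v) ->
  forall u, C u -> D u = D (0, 0).
Hypothesis C_bnd : forall u, C u -> (`|u.1| < N)%N /\ (`|u.2| < N)%N.

Let C_bad u v : nearest u v -> C u && ~~ C v ==> ~~ good v.
Proof.
move=> uv; apply/implyP => /andP[Cu /negP nCv]; apply/negP => gv.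
by apply: nCv; apply: C_closed uv Cu gv.
Qed.

Variable b0 : Z2.
Let starb (u v : Z2) := star u v && ~~ good v.
Let r (u : Z2) : bool := `[< exists2 p, path starb b0 p & last b0 p = u >].

Let r_step u v : star u v -> ~~ good v -> r u -> r v.
Proof.
move=> uv gv /asboolP[p hp lp]; apply/asboolP; exists (rcons p v).
  by rewrite rcons_path hp lp /starb uv.
by rewrite last_rcons.
Qed.

Let r_eq u v : star u v -> ~~ good u && ~~ good v ==> (r u == r v).
Proof.
move=> uv; apply/implyP => /andP[gu gv]; apply/eqP; apply/idP/idP; first exact: r_step.
by apply: r_step => //; move: uv; rewrite /star; lia.
Qed.

(** A mod 2 cochain on lattice edges. It marks the edges that leave [C] at a site of [r]; [h_square]
    says that it is closed. *)
Let h u v := [|| [&& C u, ~~ C v & r v] | [&& C v, ~~ C u & r u]].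

Let h_square x y : h (x, y) (x + 1, y) (+) h (x + 1, y) (x + 1, y + 1) (+)
  h (x, y + 1) (x + 1, y + 1) (+) h (x, y) (x, y + 1) = false.
Proof.
by apply: (@square_parity _ _ _ _ (good (x, y)) (good (x + 1, y))
  (good (x + 1, y + 1)) (good (x, y + 1)));
  (apply: C_bad || apply: r_eq); rewrite /nearest /star /=; lia.
Qed.

Let h_out u v : C u = false -> C v = false -> h u v = false.
Proof. by move=> Cu Cv; rewrite /h Cu Cv. Qed.

Let C_out (u : Z2) : (N <= `|u.1|)%N || (N <= `|u.2|)%N -> C u = false.
Proof. by move=> uN; apply/negP => /C_bnd; lia. Qed.

(* The primitive of the closed cochain [h], normalised to vanish at height [N]. *)
Let D (u : Z2) : bool :=
  \big[addb/false]_(k < `|N%:Z - u.2|) h (u.1, u.2 + k%:Z) (u.1, u.2 + k%:Z + 1).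

Let D_out (u : Z2) : (N <= `|u.1|)%N || (N%:Z <= u.2) -> D u = false.
Proof.
move=> uN; rewrite /D big1 // => k _; apply: h_out; apply: C_out => /=; lia.
Qed.

Let D_v x y : D (x, y) = h (x, y) (x, y + 1) (+) D (x, y + 1).
Proof.
have [yN|yN] := leP N%:Z y.
  by rewrite !D_out ?h_out ?C_out //=; lia.
rewrite /D /=; have -> : absz (N%:Z - y)%R = (absz (N%:Z - (y + 1))%R).+1 by lia.
rewrite big_ord_recl /= addr0; congr (_ (+) _); apply: eq_bigr => k _.
by rewrite /bump /= add1n -addn1 PoszD [(k%:Z + 1)]addrC !addrA.
Qed.

(** Downward induction from height [N], at and above which everything vanishes; closedness of [h] on
    the unit square gives the inductive step. *)
Let D_h x y : D (x, y) = h (x, y) (x + 1, y) (+) D (x + 1, y).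
Proof.
have [n] := ubnP (absz (N%:Z - y)%R); elim: n y => // n IH y yn.
have [yN|yN] := leP N%:Z y.
  by rewrite !D_out ?h_out ?C_out //=; lia.
rewrite D_v [D (x + 1, y)]D_v IH; last by lia.
move: (h_square x y).
by case: (h _ _); case: (h _ _); case: (h _ _); case: (h _ _); case: (D _).
Qed.

Let D_edge u v : nearest u v -> C u -> C v -> D u = D v.
Proof.
have hC u' v' : C u' -> C v' -> h u' v' = false by rewrite /h => -> ->.
case: u => x y; case: v => x' y'; rewrite /nearest /= => uv.
have : [\/ x' = x /\ y' = y + 1, x' = x /\ y = y' + 1,
           x' = x + 1 /\ y' = y | x = x' + 1 /\ y' = y].
  have : [|| (x' == x) && (y' == y + 1), (x' == x) && (y == y' + 1),
           (x' == x + 1) && (y' == y) | (x == x' + 1) && (y' == y)] by lia.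
  by case/or4P => /andP[/eqP ? /eqP ?];
    [constructor 1|constructor 2|constructor 3|constructor 4].
by case=> -[-> ->] Cu Cv; [rewrite D_v|rewrite [RHS]D_v|rewrite D_h|rewrite [RHS]D_h];
  rewrite hC.
Qed.

(** The potential [D] vanishes on the axis to the right of [i] and jumps across the edge leaving [C]
    there, so it is true on all of [C], in particular at the origin. Far to the left it is false
    again, so some edge of the negative axis is marked by [h], and its endpoint outside [C] is
    reached from [b0]. *)
Lemma contour_crossing (i : nat) : b0 = (i.+1%:Z, 0) -> C (i%:Z, 0) ->
  (forall j : nat, (i < j)%N -> ~~ C (j%:Z, 0)) ->
  exists p, [/\ path starb b0 p, ((last b0 p).1 <= 0)%R & uniq (b0 :: p)].
Proof.
move=> b0E Ci Cj.
have D0 : D (0, 0).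
  rewrite -(C_conn D_edge Ci) D_h; set h0 := h _ _.
  have -> : h0.
    rewrite /h0 /h; apply/orP; left; apply/and3P; split => //.
      have -> : i%:Z + 1 = i.+1%:Z by lia.
      exact: Cj.
    apply/asboolP; exists [::] => //=; rewrite b0E; congr (_, _); lia.
  have -> // : D (i%:Z + 1, 0) = false.
  have -> : i%:Z + 1 = i.+1%:Z by lia.
  suff E (m : nat) : D (i.+1%:Z, 0) = D ((i.+1 + m)%:Z, 0).
    by rewrite (E N) D_out //=; lia.
  elim: m => [|m ->]; first by rewrite addn0.
  rewrite D_h h_out /=.
  - by congr D; congr (_, _); lia.
  - by apply/negbTE/Cj; lia.
  - have -> : (i.+1 + m)%:Z + 1 = (i.+1 + m).+1%:Z by lia.
    by apply/negbTE/Cj; lia.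
(* If no edge to the left of the origin were marked, [D] would stay true down to [(-N, 0)], where it
   is false. *)
have [j /and3P[j1 j2 j3]] : exists j : nat, [&& ~~ C (- j.+1%:Z, 0) || ~~ C (- j%:Z, 0),
    h (- j.+1%:Z, 0) (- j%:Z, 0) & true].
  apply: contrapT => nh.
  have E (m : nat) : D (0, 0) = D (- m%:Z, 0).
    elim: m => [|m ->]; first by congr D; congr (_, _); lia.
    rewrite [RHS]D_h; have -> : - m.+1%:Z + 1 = - m%:Z by lia.
    case hE : (h _ _) => //; exfalso; apply: nh; exists m; rewrite hE !andbT.
    by move: hE; rewrite /h; case: (C _); case: (C _).
  by move: D0; rewrite (E N) D_out //=; lia.
have [u ru u0] : exists2 u, r u & (u.1 <= 0)%R.
  by move: j2; rewrite /h => /orP[] /and3P[_ _ ru]; eexists; try exact: ru; rewrite /=; lia.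
move/asboolP: ru => [p hp lp].
case: (shortenP hp) lp => q hq uq _ lq.
by exists q; rewrite lq.
Qed.

End Contour.

Lemma star_path_drift (b : Z2) p : path star b p ->
  (b.1 - (last b p).1 <= (size p)%:Z)%R.
Proof.
elim: p b => [|v p IH] b /=; first by lia.
by move=> /andP[bv /IH]; move: bv; rewrite /star; lia.
Qed.

(* The contour surrounds [0] and meets the positive axis at [(i, 0)], so it has
   more than [i] sites. *)
Lemma finite_cluster_contour (good C : pred Z2) (N : nat) :
  (good (0, 0) -> C (0, 0)) ->
  (forall u v, nearest u v -> C u -> good v -> C v) ->
  (forall D : pred Z2,
    (forall u v, nearest u v -> C u -> C v -> D u = D v) ->
    forall u, C u -> D u = D (0, 0)) ->
  (forall u, C u -> (`|u.1| < N)%N /\ (`|u.2| < N)%N) ->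
  exists (i : nat) (p : seq Z2),
    [/\ size p = i, path star (i%:Z, 0) p, uniq ((i%:Z, 0) :: p) &
        all (fun z => ~~ good z) ((i%:Z, 0) :: p)].
Proof.
move=> C0 Cc Cconn Cb.
(* A bad origin is by itself a contour, with [i = 0]. *)
have [g0|g0] := boolP (good (0, 0)); last first.
  by exists 0%N, [::]; rewrite /= g0.
have {g0}C0 := C0 g0.
have exC : exists n : nat, C (n%:Z, 0) by exists 0%N.
have bnd (n : nat) : C (n%:Z, 0) -> (n <= N)%N by move=> /Cb /=; lia.
(* [i] is the rightmost point of [C] on the positive axis, so the contour starts at [i + 1]. *)
case: (ex_maxnP exC bnd) => i Ci imax.
have Cj j : (i < j)%N -> ~~ C (j%:Z, 0).
  by move=> ij; apply/negP => /imax; lia.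
have [p [hp lp up]] := contour_crossing C0 Cc Cconn Cb (erefl _) Ci Cj.
have sp : path star (i.+1%:Z, 0) p by apply: sub_path hp => u v /andP[].
have szp : (i.+1 <= size p)%N 
  by move: (star_path_drift sp) lp; case: (last _ _) => a b /=; lia.
have ap : all (fun z => ~~ good z) p.
  elim: p (i.+1%:Z, 0) hp {lp up sp szp} => //= v p IH b /andP[/andP[_ ->]].
  exact: IH.
(* The contour drifts left by at least [i + 1], hence has that many steps. Truncating it makes its
   length a function of its starting point. *)
exists i.+1, (take i.+1 p); split.
- by rewrite size_takel.
- exact: take_path.
- by apply: (subseq_uniq _ up); rewrite /= eqxx; exact: take_subseq.
- rewrite /=; apply/andP; split.
    apply/negP => gi; have := Cj i.+1 (ltnSn _); apply/negP/negPn.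
    by apply: Cc Ci gi; rewrite /nearest /=; lia.
  by apply/allP => z /mem_take; move/allP: ap; apply.
Qed.

(** * Expectations of products of independent functionals *)

Lemma ge_nneseries_term (R : realType) (u : (\bar R)^nat) (k : nat) :
  (forall n, 0 <= u n)%E -> (u k <= \sum_(0 <= n <oo) u n)%E.
Proof.
move=> u0; rewrite (nneseriesD1 (n := k)) //.
by apply: leeDl; apply: nneseries_ge0.
Qed.

(** The factor may be [+oo]; both sides are then [+oo] or [0] according to whether some term is
    positive. *)
Lemma nneseriesZr_ge0 (R : realType) (u : (\bar R)^nat) (x : \bar R) :
  (forall n, 0 <= u n)%E -> (0 <= x)%E ->
  ((\sum_(0 <= n <oo) u n) * x = \sum_(0 <= n <oo) (u n * x))%E.
Proof.
move=> u0; case: x => [r| |] // r0.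
  by rewrite muleC -nneseriesZl //; apply: eq_eseriesr => n _; rewrite muleC.
have [[k uk]|] := pselect (exists k, 0 < u k)%E.
  have s0 : (0 < \sum_(0 <= n <oo) u n)%E.
    by apply: lt_le_trans uk _; exact: ge_nneseries_term.
  rewrite gt0_muley //; apply/esym/eqP; rewrite -leye_eq.
  apply: le_trans (@ge_nneseries_term _ (fun n => u n * +oo)%E k _).
    by rewrite gt0_muley.
  by move=> n; exact: mule_ge0.
move=> /forallNP u_le0.
have uE n : u n = 0%E.
  by apply/eqP; rewrite eq_le u0 andbT leNgt; apply/negP; exact: u_le0.
by rewrite !eseries0 ?mul0e // => n _ _; rewrite uE ?mul0e.
Qed.

Section IndependentMean.
Context d (T : measurableType d) (R : realType) (P : probability T R).
Local Open Scope ereal_scope.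
Implicit Types (cyl : set T -> \bar R -> Prop) (Y h : T -> \bar R) (m : \bar R).

(* [Y] has mean [m] and is independent of every [h] that is independent of the
   events [E] with [cyl E q], where [q] is the probability of [E]. *)
Definition indep_mean cyl Y m : Prop :=
  [/\ measurable_fun setT Y, (forall w, 0 <= Y w), 0 <= m &
      forall h, measurable_fun setT h -> (forall w, 0 <= h w) ->
        (forall E q, cyl E q -> \int[P]_(w in E) h w = q * \int[P]_w h w) ->
        \int[P]_w (Y w * h w) = m * \int[P]_w h w].

Lemma integral_setI_indicl (D A : set T) h :
  \int[P]_(w in D) ((\1_A w)%:E * h w) = \int[P]_(w in D `&` A) h w.
Proof.
rewrite integral_mkcondr; apply: eq_integral => w _.
by rewrite /patch indicE; case: ifP => _; rewrite ?mul1e ?mul0e.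
Qed.

Lemma measurable_indic_ereal (A : set T) : measurable A ->
  measurable_fun setT (fun w => (\1_A w)%:E : \bar R).
Proof.
by move=> mA; apply/measurable_EFinP; exact: measurable_indic.
Qed.

Lemma indep_mean_indic cyl (E : set T) q : measurable E -> 0 <= q -> cyl E q ->
  indep_mean cyl (fun w => (\1_E w)%:E) q.
Proof.
move=> mE q0 cE; split => //.
- exact: measurable_indic_ereal.
- by move=> h mh h0 /(_ _ _ cE) <-; rewrite integral_setI_indicl setTI.
Qed.

(** Serves events that are not given as cylinders, such as an infinite point count: a null event has
    mean zero against any [h]. *)
Lemma indep_mean_null cyl (E : set T) : measurable E -> P E = 0 ->
  indep_mean cyl (fun w => (\1_E w)%:E) 0.
Proof.
move=> mE PE; split => //.
- exact: measurable_indic_ereal.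
- move=> h mh h0 _; rewrite integral_setI_indicl setTI mul0e.
  by apply: null_set_integral => //; exact: measurable_funTS.
Qed.

Lemma indep_meanD cyl Y1 Y2 m1 m2 : indep_mean cyl Y1 m1 ->
  indep_mean cyl Y2 m2 -> indep_mean cyl (fun w => Y1 w + Y2 w) (m1 + m2).
Proof.
move=> [mY1 Y10 m10 i1] [mY2 Y20 m20 i2]; split.
- exact: emeasurable_funD.
- by move=> w; apply: adde_ge0.
- exact: adde_ge0.
- move=> h mh h0 ih; rewrite ge0_muleDl // -i1 // -i2 // -ge0_integralD //.
  + by apply: eq_integral => w _; rewrite ge0_muleDl.
  + by move=> w _; apply: mule_ge0.
  + exact: emeasurable_funM.
  + by move=> w _; apply: mule_ge0.
  + exact: emeasurable_funM.
Qed.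

Lemma indep_meanZ cyl Y m (r : \bar R) : 0 <= r -> indep_mean cyl Y m ->
  indep_mean cyl (fun w => r * Y w) (r * m).
Proof.
move=> r0 [mY Y0 m0 i]; split.
- by apply: emeasurable_funM => //; exact: measurable_cst.
- by move=> w; apply: mule_ge0.
- exact: mule_ge0.
- move=> h mh h0 ih; rewrite -muleA -i // -ge0_integralZl //.
  + by apply: eq_integral => w _; rewrite muleA.
  + exact: emeasurable_funM.
  + by move=> w _; apply: mule_ge0.
Qed.

Lemma indep_mean_series cyl (Y : nat -> T -> \bar R) (m : nat -> \bar R) :
  (forall k, indep_mean cyl (Y k) (m k)) ->
  indep_mean cyl (fun w => \sum_(0 <= k <oo) Y k w) (\sum_(0 <= k <oo) m k).
Proof.
move=> iY.
have mY k : measurable_fun setT (Y k) by case: (iY k).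
have Y0 k w : 0 <= Y k w by case: (iY k).
have m0 k : 0 <= m k by case: (iY k).
split.
- by apply: ge0_emeasurable_sum => // k w _ _.
- by move=> w; apply: nneseries_ge0.
- exact: nneseries_ge0.
- move=> h mh h0 ih; rewrite nneseriesZr_ge0 //; last exact: integral_ge0.
  under eq_integral do rewrite nneseriesZr_ge0 //.
  rewrite integral_nneseries //.
  + by apply: eq_eseriesr => k _; case: (iY k) => _ _ _; exact.
  + by move=> k; exact: emeasurable_funM.
  + by move=> k w _; exact: mule_ge0.
Qed.

Lemma indep_mean_sum cyl (I : Type) (s : seq I) (Y : I -> T -> \bar R) (m : I -> \bar R) :
  (forall k, indep_mean cyl (Y k) (m k)) ->
  indep_mean cyl (fun w => \sum_(k <- s) Y k w) (\sum_(k <- s) m k).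
Proof.
move=> iY; elim: s => [|k s IH].
  have -> : (fun w => \sum_(k <- [::]) Y k w) = cst 0.
    by apply/funext => w; rewrite big_nil.
  rewrite big_nil; split => //.
  by move=> h _ _ _; under eq_integral do rewrite mul0e; rewrite integral0 mul0e.
have -> : (fun w => \sum_(j <- k :: s) Y j w) = (fun w => Y k w + \sum_(j <- s) Y j w).
  by apply/funext => w; rewrite big_cons.
by rewrite big_cons; exact: indep_meanD.
Qed.

End IndependentMean.

(** * Simultaneous large values at separated sites *)

Section ProductMarkov.
Context d (T : measurableType d) (R : realType) (P : probability T R).
Local Open Scope ereal_scope.
Variables (S : Type) (sep : rel S) (cyl : S -> set T -> \bar R -> Prop).
Hypothesis sepC : symmetric sep.
Hypothesis cyl_measurable : forall z E q, cyl z E q -> measurable E.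

Fixpoint all_cyl (t : seq (S * (set T * \bar R))) : Prop :=
  if t is x :: t' then cyl x.1 x.2.1 x.2.2 /\ all_cyl t' else True.

Hypothesis cyl_indep : forall t, pairwise sep (map fst t) -> all_cyl t ->
  P (\big[setI/setT]_(x <- t) x.2.1) = \prod_(x <- t) x.2.2.

Variables (Y : S -> T -> \bar R) (m : S -> \bar R).
Hypothesis Ym : forall z, indep_mean P (cyl z) (Y z) (m z).

Let mY z : measurable_fun setT (Y z). Proof. by case: (Ym z). Qed.
Let Y0 z w : 0 <= Y z w. Proof. by case: (Ym z). Qed.

Lemma measurable_prode (s : seq S) :
  measurable_fun setT (fun w => \prod_(z <- s) Y z w).
Proof.
elim: s => [|z s IH].
  by under eq_fun do rewrite big_nil; exact: measurable_cst.
by under eq_fun do rewrite big_cons; exact: emeasurable_funM.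
Qed.

(** Induction on [s], for all lists [t] of cylinder events at once: factoring out [Y z] requires the
    remaining product to be independent of each cylinder event at [z], and this is the induction
    hypothesis with that event added to [t]. *)
Lemma integral_prod_indep_mean (s : seq S) t : pairwise sep (s ++ map fst t) -> all_cyl t ->
  \int[P]_(w in \big[setI/setT]_(x <- t) x.2.1) \prod_(z <- s) Y z w =
  (\prod_(x <- t) x.2.2) * \prod_(z <- s) m z.
Proof.
elim: s t => [|z s IH] t.
  move=> /= st ct; under eq_integral do rewrite big_nil.
  rewrite integral_cst ?mul1e ?big_nil ?mule1; first exact: cyl_indep.
  elim: t ct {st} => [|x t IHt] /=; first by rewrite big_nil => _; exact: measurableT.
  by move=> [cx /IHt]; rewrite big_cons; apply: measurableI; apply: cyl_measurable cx.
rewrite /= all_cat => /andP[/andP[zs zt] st] ct.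
have mt : measurable (\big[setI/setT]_(x <- t) x.2.1).
  elim: t ct {st zt} => [|x t IHt] /=; first by rewrite big_nil => _; exact: measurableT.
  by move=> [cx /IHt]; rewrite big_cons; apply: measurableI; apply: cyl_measurable cx.
set A := \big[setI/setT]_(x <- t) x.2.1.
pose h w := (\1_A w)%:E * \prod_(z <- s) Y z w.
have p0 w : 0 <= \prod_(z <- s) Y z w by apply: prode_ge0 => ? _.
have -> : \int[P]_(w in A) \prod_(y <- z :: s) Y y w = \int[P]_w (Y z w * h w).
  rewrite -[in LHS](setTI A) -integral_setI_indicl; apply: eq_integral => w _.
  by rewrite /h big_cons muleCA.
have [_ _ _ ->] := Ym z.
- rewrite /h integral_setI_indicl setTI IH // big_cons muleCA //.
- apply: emeasurable_funM; [exact: measurable_indic_ereal|exact: measurable_prode].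
- by move=> w; rewrite /h mule_ge0 // lee_fin indicE.
- move=> E q cE; rewrite /h !integral_setI_indicl setTI IH //.
  have := IH ((z, (E, q)) :: t); rewrite !big_cons /= -muleA => -> //.
  rewrite pairwise_cat allrel_consr /= zt.
  move: st; rewrite pairwise_cat => /and3P[-> -> ->]; rewrite !andbT.
  by rewrite (eq_all (a2 := sep z)) // => y; rewrite sepC.
Qed.

(** The product of the [Y z] is at least [1] on the event, so its expectation, which factorises,
    dominates the probability. *)
Lemma prod_markov (s : seq S) : pairwise sep s ->
  P (\big[setI/setT]_(z <- s) [set w | 1 <= Y z w]) <= \prod_(z <- s) m z.
Proof.
move=> ss.
have mE z : measurable [set w | 1 <= Y z w].
  by rewrite -[X in measurable X]setTI; exact: emeasurable_fun_c_infty.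
have mA : measurable (\big[setI/setT]_(z <- s) [set w | 1 <= Y z w]).
  by elim/big_ind : _ => // *; exact: measurableI.
have := @integral_prod_indep_mean s [::]; rewrite /= cats0 !big_nil mul1e.
move=> /(_ ss I) <-.
set A := \big[setI/setT]_(z <- s) _.
have p0 w : 0 <= \prod_(z <- s) Y z w by apply: prode_ge0 => ? _.
apply: (@le_trans _ _ (\int[P]_(w in A) \prod_(z <- s) Y z w)); last first.
  by apply: ge0_subset_integral => //; exact: measurable_prode.
rewrite -[leLHS]mul1e -integral_cst //; apply: ge0_le_integral => //.
- exact: measurable_funTS (measurable_prode s).
move=> w; rewrite /A {A mA p0 ss} /=.
elim: s => [|z s IH]; first by rewrite !big_nil.
rewrite !big_cons => -[/= z1 /IH s1].
by rewrite -[leLHS]mule1; apply: lee_pmul.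
Qed.

End ProductMarkov.

(** * Cylinder events of the marked Poisson model *)

(* Each oriented edge is charged to exactly one of its endpoints, so that distinct
   sites depend on distinct fading variables. *)
Definition site_edge (z : Z2) (i : bool * bool) : Z2 * Z2 :=
  let z' : Z2 := if i.1 then (z.1 + 1, z.2) else (z.1, z.2 + 1) in
  if i.2 then (z, z') else (z', z).

Lemma site_edge_inj : injective (fun x : Z2 * (bool * bool) => site_edge x.1 x.2).
Proof.
move=> [[x y] [i j]] [[x' y'] [i' j']]; rewrite /site_edge /=.
by case: i; case: j; case: i'; case: j' => /= -[] *; congr (_, _, _);
  lia || (exfalso; lia).
Qed.

Definition separated (L : nat) (z z' : Z2) : bool :=
  (L <= `|z.1 - z'.1|)%N || (L <= `|z.2 - z'.2|)%N.

Lemma separatedC L : symmetric (separated L).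
Proof. by move=> z z'; rewrite /separated !(distnC z.1) !(distnC z.2). Qed.

Lemma tnth_all_cyl d (T : measurableType d) (R : realType) (S : Type)
    (cyl : S -> set T -> \bar R -> Prop) t (i : 'I_(size t)) : all_cyl cyl t ->
  cyl (tnth (in_tuple t) i).1 (tnth (in_tuple t) i).2.1 (tnth (in_tuple t) i).2.2.
Proof.
rewrite (tnth_nth (tnth (in_tuple t) i)) /=; move: (tnth _ i) (ltn_ord i) => x0.
elim: t {i} (nat_of_ord i) => //= x t IH [|k] kt [cx ct] //=.
exact: IH.
Qed.

Section Slab.
Context {R : realType}.

(** Squares replace discs so that the product measure is a product of interval lengths. *)
Definition box (z : Z2) (r : R) : set (R * R) :=
  `]z.1%:~R - r, z.1%:~R + r[ `*` `]z.2%:~R - r, z.2%:~R + r[.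

Lemma box_separated (L : nat) (r : R) (z z' : Z2) : 2 * r <= L%:R ->
  separated L z z' -> box z r `&` box z' r = set0.
Proof.
move=> rL; suff far (a b : int) (x : R) : (L <= `|a - b|)%N ->
    a%:~R - r < x < a%:~R + r -> b%:~R - r < x < b%:~R + r -> False.
  move=> zz'; rewrite -subset0 => -[x y] [[/= x1 y1] [/= x2 y2]].
  move: x1 y1 x2 y2; rewrite !in_itv /= => x1 y1 x2 y2.
  by case/orP: zz' => /far; [move=> /(_ x)|move=> /(_ y)]; apply.
move=> ab /andP[h1 h2] /andP[h3 h4].
have : (L%:R <= `|a%:~R - b%:~R| :> R).
  by rewrite -intrB -intr_norm -[L%:R]/(L%:Z%:~R) ler_int; lia.
by rewrite ler_normr => /orP[] h5; lra.
Qed.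

End Slab.

Section Model.
Context (R : realType) (lam : R) (F Lg LW : probability R R).
Context d (T : measurableType d) (P : probability T R).
Variables (Phi : T -> set (@mpoint R)) (g : Z2 -> Z2 -> T -> R) (W : Z2 -> T -> R).
Hypothesis model : marked_model P lam F Lg LW Phi g W.

(** The product formula for arbitrary finite index types: the fading variables of several sites are
    indexed by pairs of a site and an edge label. *)
Lemma marked_model_fin (I J K : finType) (e : I -> Z2 * Z2) (B : I -> set R)
    (u : J -> Z2) (C : J -> set R) (D : K -> set (@mpoint R)) (k : K -> nat) :
  injective e -> injective u ->
  (forall i, measurable (B i)) -> (forall j, measurable (C j)) ->
  (forall i, measurable (D i)) ->
  (forall i, (intensity lam F (D i) < +oo)%E) ->
  (forall i i', i != i' -> D i `&` D i' = set0) ->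
  P (\bigcap_(i in [set: I]) (g (e i).1 (e i).2 @^-1` B i)
     `&` \bigcap_(j in [set: J]) (W (u j) @^-1` C j)
     `&` \bigcap_(i in [set: K]) [set w | npoints (Phi w `&` D i) = (k i)%:R%:E])
  = ((\prod_i Lg (B i)) * (\prod_j LW (C j))
     * \prod_i (pois_pmf (fine (intensity lam F (D i))) (k i))%:E)%E.
Proof.
move=> ei ui mB mC mD fD dD.
have capE (X : finType) (A : X -> set T) : \bigcap_(i in [set: X]) A i =
    \bigcap_(i in [set: 'I_#|X|]) A (enum_val i).
  apply/seteqP; split => w h i _; first exact: h.
  by rewrite -(enum_rankK i); exact: h.
have prodE (X : finType) (a : X -> \bar R) :
    (\prod_i a i = \prod_(i < #|X|) a (enum_val i))%E.
  by rewrite (reindex (@enum_val X X)) //; exact: onW_bij (enum_val_bij _).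
rewrite (capE I) (capE J) (capE K) (prodE I) (prodE J) (prodE K).
case: model => _ _ _ _; apply => //.
- by move=> x y /ei /enum_val_inj.
- by move=> x y /ui /enum_val_inj.
- by move=> i i' ii'; apply: dD; apply: contra ii' => /eqP /enum_val_inj ->.
Qed.

Variables (L : nat) (r : R).
Hypotheses (L0 : (0 < L)%N) (rL : 2 * r <= L%:R).

Record cylinder_data := CylinderData {
  cyl_g : bool * bool -> set R; cyl_W : set R; cyl_D : set (@mpoint R); cyl_n : nat }.

(** Counting sets are confined to the box of half-side [r] around [z], so separated sites observe
    disjoint parts of the point process. *)
Definition cylinder_ok (z : Z2) (c : cylinder_data) : Prop :=
  [/\ forall i, measurable (cyl_g c i), measurable (cyl_W c), measurable (cyl_D c),
      cyl_D c `<=` box z r `*` setT & (intensity lam F (cyl_D c) < +oo)%E].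

Definition cylinder_event (z : Z2) (c : cylinder_data) : set T :=
  \bigcap_(i in [set: bool * bool])
     (g (site_edge z i).1 (site_edge z i).2 @^-1` cyl_g c i)
  `&` (W z @^-1` cyl_W c)
  `&` [set w | npoints (Phi w `&` cyl_D c) = (cyl_n c)%:R%:E].

Definition cylinder_proba (c : cylinder_data) : \bar R :=
  ((\prod_i Lg (cyl_g c i)) * LW (cyl_W c)
   * (pois_pmf (fine (intensity lam F (cyl_D c))) (cyl_n c))%:E)%E.

Definition cylinder (z : Z2) (E : set T) (q : \bar R) : Prop :=
  exists c, [/\ cylinder_ok z c, E = cylinder_event z c & q = cylinder_proba c].

Lemma measurable_cylinder_event z c : cylinder_ok z c ->
  measurable (cylinder_event z c).
Proof.
case: model => _ mg mW mN _ [mB mC mD _ _].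
apply: measurableI; first apply: measurableI.
- by apply: fin_bigcap_measurable => //; move=> i _; exact: mg.
- exact: mW.
- exact: mN.
Qed.

Lemma cylinder_measurable z E q : cylinder z E q -> measurable E.
Proof. by move=> [c [cok -> _]]; exact: measurable_cylinder_event. Qed.

(** Separated sites have different noise variables, different fading variables by [site_edge_inj]
    and disjoint counting sets by [box_separated]. The whole intersection is thus one event of the
    product formula, whose factors are regrouped site by site. *)
Lemma cylinder_indep (t : seq (Z2 * (set T * \bar R))) :
  pairwise (separated L) (map fst t) -> all_cyl cylinder t ->
  P (\big[setI/setT]_(x <- t) x.2.1) = (\prod_(x <- t) x.2.2)%E.
Proof.
move=> st ct; pose l := size t; pose tn (i : 'I_l) := tnth (in_tuple t) i.
have /choice[c hc] : forall i, exists c, [/\ cylinder_ok (tn i).1 c,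
    (tn i).2.1 = cylinder_event (tn i).1 c & (tn i).2.2 = cylinder_proba c].
  by move=> i; exact: (tnth_all_cyl i ct).
have sepi i i' : i != i' -> separated L (tn i).1 (tn i').1.
  wlog ii' : i i' / (i < i')%N.
    move=> H; rewrite -val_eqE neq_ltn => /orP[] ii'.
      by apply: H; rewrite // -val_eqE neq_ltn ii'.
    by rewrite separatedC; apply: H; rewrite // -val_eqE neq_ltn ii'.
  move=> _; have /(pairwiseP (tn i).1) /(_ i i') := st.
  rewrite !inE size_map !ltn_ord => /(_ isT isT ii').
  have tnE j : tn j = nth (tn i) t j by rewrite /tn (tnth_nth (tn i)).
  by rewrite !(nth_map (tn i)) // -!tnE.
have inj : injective (fun i => (tn i).1).
  move=> i i' ii'; apply/eqP/negPn/negP => /sepi; rewrite ii' /separated !subrr.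
  by rewrite absz0 leqNgt L0.
rewrite big_tnth [RHS]big_tnth -/l.
have -> : \big[setI/setT]_(i < l) (tnth (in_tuple t) i).2.1 =
    \bigcap_(x in [set: 'I_l * (bool * bool)])
      (g (site_edge (tn x.1).1 x.2).1 (site_edge (tn x.1).1 x.2).2 @^-1` cyl_g (c x.1) x.2)
    `&` \bigcap_(i in [set: 'I_l]) (W (tn i).1 @^-1` cyl_W (c i))
    `&` \bigcap_(i in [set: 'I_l])
          [set w | npoints (Phi w `&` cyl_D (c i)) = (cyl_n (c i))%:R%:E].
  rewrite -bigcap_seq; apply/seteqP; split => w.
    move=> h; have {}h i : cylinder_event (tn i).1 (c i) w.
      by have [_ <- _] := hc i; apply: h; rewrite /= mem_index_enum.
    by split; [split|] => [[i j] _|i _|i _]; case: (h i) => -[h1 h2] h3 //; exact: h1.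
  move=> [[h1 h2] h3] i _; have [_ -> _] := hc i.
  by split; [split|]; [move=> j _; exact: (h1 (i, j))|exact: h2|exact: h3].
rewrite (marked_model_fin (e := fun x => site_edge (tn x.1).1 x.2)
  (B := fun x => cyl_g (c x.1) x.2)).
- rewrite -(pair_bigA _ (fun i j => Lg (cyl_g (c i) j))) /= -!big_split /=.
  by apply: eq_bigr => i _; have [_ _ ->] := hc i.
- move=> [i j] [i' j'] /= /(@site_edge_inj (_, _) (_, _)) [] /inj -> -> //.
- exact: inj.
- by move=> [i j]; have [[]] := hc i.
- by move=> i; have [[]] := hc i.
- by move=> i; have [[]] := hc i.
- by move=> i; have [[]] := hc i.
- move=> i i' /sepi sii'; rewrite -subset0 => -[x p] [].
  have [[_ _ _ D1 _] _ _] := hc i; have [[_ _ _ D2 _] _ _] := hc i'.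
  move=> /D1 [/= b1 _] /D2 [/= b2 _].
  by have := box_separated rL sii'; rewrite -subset0; apply; split; [exact: b1|exact: b2].
Qed.

End Model.

(** * Poisson counts *)

Section Poisson.
Context (R : realType).
Implicit Types m : R.

Lemma pois_pmf_ge0 m k : 0 <= m -> 0 <= pois_pmf m k.
Proof.
by move=> m0; rewrite /pois_pmf mulr_ge0 ?expR_ge0 // divr_ge0 // exprn_ge0.
Qed.

Lemma pois_pmf_sum m : 0 <= m -> (\sum_(0 <= n <oo) (pois_pmf m n)%:E = 1)%E.
Proof.
move=> m0; have -> : 1%E = ((expR (- m))%:E * (expR m)%:E)%E.
  by rewrite -EFinM -expRD addNr expR0.
rewrite /pois_pmf; under eq_eseriesr do rewrite EFinM muleC.
rewrite nneseriesZl; last by move=> n _; rewrite lee_fin divr_ge0 // exprn_ge0.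
congr (_ * _)%E; rewrite /expR -EFin_lim; last exact: is_cvg_series_exp_coeff.
by apply/congr_lim/funext => n /=; rewrite /series /= -sumEFin.
Qed.

Lemma pois_pmf_mean m : 0 <= m ->
  (\sum_(0 <= n <oo) (n%:R%:E * (pois_pmf m n)%:E) = m%:E)%E.
Proof.
move=> m0; have p0 n : (0 <= n%:R%:E * (pois_pmf m n)%:E)%E.
  by rewrite mule_ge0 // lee_fin pois_pmf_ge0.
rewrite nneseries_recl // mul0e add0e -nneseries_addn //.
(* After the shift, the mass at [n + 1] times [n + 1] equals [m] times the mass at [n]. *)
transitivity (\sum_(0 <= n <oo) (m%:E * (pois_pmf m n)%:E))%E.
  apply: eq_eseriesr => n _; rewrite -!EFinM; congr EFin.
  rewrite /pois_pmf addn1 factS natrM exprS.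
  have n0 : n.+1%:R != 0 :> R by rewrite pnatr_eq0.
  by rewrite invfM -!mulrA mulrCA; congr (_ * _); rewrite mulrCA mulVKf.
rewrite nneseriesZl ?pois_pmf_sum ?mule1 // => n _.
by rewrite lee_fin pois_pmf_ge0.
Qed.

End Poisson.

Section Counts.
Context (R : realType) (lam : R) (F Lg LW : probability R R).
Context d (T : measurableType d) (P : probability T R).
Variables (Phi : T -> set (@mpoint R)) (g : Z2 -> Z2 -> T -> R) (W : Z2 -> T -> R).
Hypothesis model : marked_model P lam F Lg LW Phi g W.
Variables (L : nat) (r : R).
Hypotheses (L0 : (0 < L)%N) (rL : 2 * r <= L%:R) (lam0 : 0 <= lam).
Local Open Scope ereal_scope.

Notation cylinder := (cylinder lam F Lg LW Phi g W r).
Notation intensity := (intensity lam F).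

Lemma intensity_ge0 (D : set (@mpoint R)) : 0 <= intensity D.
Proof. by rewrite /intensity mule_ge0. Qed.

Lemma intensity_set0 : intensity set0 = 0.
Proof. by rewrite /intensity measure0 mule0. Qed.

Lemma npoints_set0 : @npoints R set0 = 0.
Proof. exact: esum_set0. Qed.

Lemma pois_pmf00 : pois_pmf (fine (intensity set0)) 0 = 1%R.
Proof. by rewrite intensity_set0 /pois_pmf /= expr0 oppr0 expR0 fact0 divr1 mulr1. Qed.

Lemma cylinder_ge0 z E q : cylinder z E q -> 0 <= q.
Proof.
move=> [c [_ _ ->]]; apply: mule_ge0; first by apply: mule_ge0 => //; exact: prode_ge0.
by rewrite lee_fin pois_pmf_ge0 // fine_ge0 // intensity_ge0.
Qed.

Lemma cylinder_indep_mean z E q : cylinder z E q ->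
  indep_mean P (cylinder z) (fun w => (\1_E w)%:E) q.
Proof.
move=> cE; apply: indep_mean_indic => //; first exact: (cylinder_measurable model cE).
exact: cylinder_ge0 cE.
Qed.

Lemma cylinder_proba_eq z E q : cylinder z E q -> P E = q.
Proof.
move=> cE; have := cylinder_indep model L0 rL (t := [:: (z, (E, q))]).
by rewrite !big_seq1; apply.
Qed.

Lemma cylinder_count z (D : set (@mpoint R)) n : measurable D ->
  D `<=` box z r `*` setT -> intensity D < +oo ->
  cylinder z [set w | npoints (Phi w `&` D) = n%:R%:E]
    (pois_pmf (fine (intensity D)) n)%:E.
Proof.
move=> mD Dz Dfin; exists (CylinderData (fun=> setT) setT D n); split => //=.
- by split => //=.
- by apply/seteqP; split => [w ?|w []].
- by rewrite /cylinder_proba /= big1 ?probability_setT ?mul1e // => i _; exact: probability_setT.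
Qed.

Lemma cylinder_noise z (C : set R) : measurable C -> cylinder z (W z @^-1` C) (LW C).
Proof.
(* Asking for zero points in the empty set makes the counting constraint vacuous, with Poisson mass
   [1]. *)
move=> mC; exists (CylinderData (fun=> setT) C set0 0); split => //=.
- by split => //=; rewrite intensity_set0.
- rewrite /cylinder_event /=; apply/seteqP; split => [w ?|w [[]] //].
  by split => //=; rewrite setI0 npoints_set0.
- rewrite /cylinder_proba /= pois_pmf00 mule1 big1 ?mul1e // => i _.
  exact: probability_setT.
Qed.

Lemma cylinder_fading z i (B : set R) : measurable B ->
  cylinder z (g (site_edge z i).1 (site_edge z i).2 @^-1` B) (Lg B).
Proof.
move=> mB.
exists (CylinderData (fun j => if j == i then B else setT) setT set0 0); split => //=.
- by split => //=; [move=> j; case: ifP|rewrite intensity_set0].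
- rewrite /cylinder_event /=; apply/seteqP; split => [w Bw|w [[/(_ i I)]]].
    split => //=; last by rewrite setI0 npoints_set0.
    by split => // j _ /=; case: eqP => // ->.
  by rewrite /= eqxx.
- rewrite /cylinder_proba /= pois_pmf00 mule1 probability_setT mule1.
  rewrite (bigD1 i) //= eqxx big1 ?mule1 // => j /negbTE ->.
  exact: probability_setT.
Qed.

Definition uncounted (D : set (@mpoint R)) : set T :=
  ~` \bigcup_n [set w | npoints (Phi w `&` D) = n%:R%:E].

(* A measurable version of the number of points in [D], infinite when that
   number is not finite. *)
Definition point_count (D : set (@mpoint R)) (w : T) : \bar R :=
  \sum_(0 <= n <oo) (n%:R%:E * (\1_[set w | npoints (Phi w `&` D) = n%:R%:E] w)%:E)
  + \sum_(0 <= n <oo) (\1_(uncounted D) w)%:E.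

Lemma point_count_ge0 D w : 0 <= point_count D w.
Proof.
apply: adde_ge0; apply: nneseries_ge0 => n _ _; last by rewrite lee_fin.
by rewrite mule_ge0 // lee_fin.
Qed.

Lemma npoints_le_point_count D w : npoints (Phi w `&` D) <= point_count D w.
Proof.
have [[n Dn]|nD] := pselect (exists n : nat, npoints (Phi w `&` D) = n%:R%:E).
  apply: (@le_trans _ _ (\sum_(0 <= n <oo)
      (n%:R%:E * (\1_[set w | npoints (Phi w `&` D) = n%:R%:E] w)%:E))).
    apply: le_trans (@ge_nneseries_term _ _ n _); last first.
      by move=> k; rewrite mule_ge0 // lee_fin.
    by rewrite /= indicE mem_set // mule1 Dn.
  by apply: leeDl; apply: nneseries_ge0 => k _ _; rewrite lee_fin.
(* Without a finite count, the second series of [point_count] has all its terms equal to [1] and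
   diverges. *)
have -> : point_count D w = +oo; last exact: leey.
apply/eqP; rewrite -leye_eq /point_count.
apply: (@le_trans _ _ (\sum_(0 <= n <oo) (\1_(uncounted D) w)%:E)); last first.
  by apply: leeDr; apply: nneseries_ge0 => k _ _; rewrite mule_ge0 // lee_fin.
rewrite indicE mem_set; last by move=> [n _ Dn]; apply: nD; exists n.
rewrite leye_eq; apply/eqP/eq_infty => x.
apply: le_trans (@nneseries_lim_ge _ _ xpredT 0%N (Num.truncn x).+1 _) => //.
rewrite sumEFin lee_fin big_const_nat subn0 iter_addr_0.
by apply/ltW/truncnS_gt.
Qed.

Lemma point_count_indep_mean z (D : set (@mpoint R)) : measurable D ->
  D `<=` box z r `*` setT -> intensity D < +oo ->
  indep_mean P (cylinder z) (point_count D) (intensity D).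
Proof.
move=> mD Dz Dfin.
have fD : (fine (intensity D))%:E = intensity D.
  by rewrite fineK // ge0_fin_numE // intensity_ge0.
have fD0 : (0 <= fine (intensity D))%R by rewrite fine_ge0 // intensity_ge0.
have cD n := cylinder_count n mD Dz Dfin.
have mE n : measurable [set w | npoints (Phi w `&` D) = n%:R%:E].
  exact: (cylinder_measurable model (cD n)).
have mU : measurable (\bigcup_n [set w | npoints (Phi w `&` D) = n%:R%:E]).
  exact: bigcupT_measurable.
(* The Poisson masses sum to [1], so the count is almost surely finite. *)
have U0 : P (uncounted D) = 0.
  rewrite /uncounted probability_setC // measure_semi_bigcup //.
    rewrite -(pois_pmf_sum fD0).
    rewrite (@eq_eseriesr _ _ _ xpredT 0%N (fun n _ => cylinder_proba_eq (cD n))).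
    by rewrite pois_pmf_sum // subee.
  apply/trivIsetP => i j _ _ ij; rewrite -subset0 => w [/= ->] [] /eqP.
  by rewrite eqr_nat (negbTE ij).
rewrite -[intensity D]adde0; apply: indep_meanD.
  rewrite -fD -(pois_pmf_mean fD0); apply: indep_mean_series => n.
  by apply: indep_meanZ; [rewrite lee_fin|exact: cylinder_indep_mean].
have iU (n : nat) := indep_mean_null (cylinder z) (measurableC mU) U0.
by have := indep_mean_series iU; rewrite eseries0.
Qed.

End Counts.

(** * The interference as a sum over dyadic cells *)

Lemma esum_nneseries_le (R : realType) (X : choiceType) (S : set X)
    (v : nat -> X -> \bar R) : (forall k x, 0 <= v k x)%E ->
  (\esum_(x in S) \sum_(0 <= k <oo) v k x <= \sum_(0 <= k <oo) \esum_(x in S) v k x)%E.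
Proof.
move=> v0; apply: ge_ereal_sup => _ [A [finA AS] <-].
rewrite fsbig_finite //= -nneseries_sum //.
apply: lee_nneseries => [k _ _|k _]; first exact: sume_ge0.
by rewrite -fsbig_finite //; apply: ereal_sup_ubound; exists A.
Qed.

Lemma esumZ_le (R : realType) (X : choiceType) (S : set X) (a : \bar R)
    (v : X -> \bar R) : (0 <= a)%E -> (forall x, 0 <= v x)%E ->
  (\esum_(x in S) (a * v x) <= a * \esum_(x in S) v x)%E.
Proof.
move=> a0 v0; apply: ge_ereal_sup => _ [A [finA AS] <-].
rewrite fsbig_finite //= -ge0_sume_distrr //; apply: lee_wpmul2l => //.
by rewrite -fsbig_finite //; apply: ereal_sup_ubound; exists A.
Qed.

Lemma esum_indic_npoints (R : realType) (S D : set (@mpoint R)) :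
  (\esum_(x in S) (\1_D x)%:E = npoints (S `&` D))%E.
Proof.
rewrite /npoints esum_mkcondr; apply: eq_esum => x _.
by rewrite indicE; case: ifP.
Qed.

(** The number of naturals strictly below [p] is the ceiling of [p]. The lower bound dominates a
    mark by a count, the upper one controls the mean of that count. *)
Lemma series_indic_gt (R : realType) (p : R) : 0 < p ->
  exists2 n : nat, p <= n%:R <= p + 1 &
    (\sum_(0 <= j <oo) (\1_(`]j%:R, +oo[ : set R) p)%:E = n%:R%:E :> \bar R)%E.
Proof.
move=> p0; have exn : exists n : nat, p <= n%:R.
  by exists (Num.truncn p).+1; apply/ltW/truncnS_gt.
case: (ex_minnP exn) => n pn nmin; exists n.
  rewrite pn /=; case: n pn nmin => [|n] _ nmin; first by rewrite addr_ge0 // ltW.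
  rewrite -natr1 lerD2r leNgt; apply/negP => /ltW /nmin; by rewrite ltnn.
have ind j : \1_(`]j%:R, +oo[ : set R) p = (j < n)%N%:R :> R.
  rewrite indicE; congr (nat_of_bool _)%:R; apply/idP/idP.
    rewrite inE /= in_itv /= andbT => jp.
    by rewrite -(ltr_nat R); exact: lt_le_trans pn.
  move=> jn; rewrite inE /= in_itv /= andbT ltNge; apply/negP => /nmin.
  by rewrite leqNgt jn.
rewrite (nneseries_split 0 n) //.
rewrite add0n [X in (_ + X)%E]eseries0 ?adde0; last first.
  by move=> j nj _; rewrite ind ltnNge nj.
rewrite sumEFin; congr EFin.
rewrite big_nat (eq_bigr (fun=> 1)); last by move=> j /andP[_ jn]; rewrite ind jn.
by rewrite -big_nat big_const_nat subn0 iter_addr_0.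
Qed.

Lemma dyadic_bracket (R : realType) (y : R) : 1 <= y ->
  exists k : nat, 2 ^+ k <= y < 2 ^+ k.+1.
Proof.
move=> y1; have exk : exists k : nat, y < 2 ^+ k.
  exists (Num.truncn y).+1; apply: lt_le_trans (truncnS_gt y) _.
  by rewrite -natrX ler_nat ltnW // ltn_expl.
case: (ex_minnP exk) => -[|k] yk kmin; first by move: yk; rewrite expr0 ltNge y1.
exists k; rewrite yk andbT leNgt; apply/negP => /kmin; by rewrite ltnn.
Qed.

Lemma powRN_le (R : realType) (b x y : R) : 0 <= b -> 0 < x -> x <= y ->
  y `^ (- b) <= x `^ (- b).
Proof.
move=> b0 x0 xy; have y0 : 0 < y by exact: lt_le_trans xy.
rewrite !powRN lef_pV2 ?posrE ?powR_gt0 //.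
by apply: ge0_ler_powR => //; rewrite nnegrE ltW.
Qed.

Lemma dist2_box (R : realType) (x : R * R) (z : Z2) (s : R) :
  dist2 x z < s -> box z s x.
Proof.
move=> ds; have le_dist (a b : R) : `|a| <= Num.sqrt (a ^+ 2 + b ^+ 2).
  by rewrite -[leLHS]sqrtr_sqr ler_sqrt ?lerDl ?sqr_ge0 // addr_ge0 ?sqr_ge0.
have := le_lt_trans (le_dist _ _) ds; have := le_dist (x.2 - z.2%:~R) (x.1 - z.1%:~R).
rewrite [_ ^+ 2 + _]addrC => /le_lt_trans /(_ ds); rewrite !ltr_norml.
move=> /andP[h1 h2] /andP[h3 h4]; split; rewrite /= in_itv /=; apply/andP; split; lra.
Qed.

Section SiteGeometry.
Context (R : realType).
Variables (s r : R) (z : Z2).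

Definition near_cell : set (@mpoint R) := box z (Num.min s r) `*` `]0, +oo[.

(* For fixed [k] a point of mark [p] lies in at least [p] of these cells, so counting
   points over all [j] dominates summing their marks. *)
Definition cell (k j : nat) : set (@mpoint R) :=
  box z (Num.min (s * 2 ^+ k.+1) r) `*` `]j%:R, +oo[.

(** The majorant of [f] at the inner radius [s * 2 ^+ k] of the dyadic shell, whereas [cell] extends
    to the outer radius [s * 2 ^+ k.+1]. *)
Definition cell_weight (B beta : R) (k : nat) : R := B * (s * 2 ^+ k) `^ (- beta).

Lemma measurable_box (q : R) : measurable (box z q).
Proof. by apply: measurableX; exact: measurable_itv. Qed.

Lemma measurable_near_cell : measurable near_cell.
Proof. by apply: measurableX; [exact: measurable_box|exact: measurable_itv]. Qed.

Lemma measurable_cell k j : measurable (cell k j).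
Proof. by apply: measurableX; [exact: measurable_box|exact: measurable_itv]. Qed.

Lemma sub_box (q q' : R) : q <= q' -> box z q `<=` box z q'.
Proof.
move=> qq' x [/=]; rewrite !in_itv /= => /andP[h1 h2] /andP[h3 h4].
by split; rewrite /= in_itv /=; apply/andP; split; lra.
Qed.

Lemma near_cell_sub : near_cell `<=` box z r `*` setT.
Proof.
by move=> xp [/= h _]; split => //=; apply: sub_box h; rewrite ge_min lexx orbT.
Qed.

Lemma cell_sub k j : cell k j `<=` box z r `*` setT.
Proof.
by move=> xp [/= h _]; split => //=; apply: sub_box h; rewrite ge_min lexx orbT.
Qed.

(** A contributing point lies at distance at least [s], as the near cell is empty, and less than
    [r]. If its dyadic shell is the [k]-th, it belongs to [cell k j] for every [j] below its mark,
    and [f] is at most the weight there. The sums are exchanged after this pointwise bound. *)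
Lemma interference_le (f : R -> \bar R) (B beta : R) (Phi : set (@mpoint R)) :
  0 < s -> 0 <= beta -> 0 <= B ->
  (forall x, r <= x -> f x = 0%E) ->
  (forall x, 0 < x -> (f x <= (B * x `^ (- beta))%:E)%E) ->
  Phi `<=` [set xp | 0 < xp.2] ->
  Phi `&` near_cell = set0 ->
  (interference f Phi z <=
   \sum_(0 <= k <oo) \sum_(0 <= j <oo)
     (cell_weight B beta k)%:E * npoints (Phi `&` cell k j))%E.
Proof.
move=> s0 beta0 B0 fr fB Phi0 Phin.
have w0 k : 0 <= cell_weight B beta k by rewrite mulr_ge0 // powR_ge0.
have v0 k j (xp : @mpoint R) :
    (0 <= (cell_weight B beta k)%:E * (\1_(cell k j) xp)%:E)%E.
  by rewrite mule_ge0 // lee_fin.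
apply: (@le_trans _ _ (\esum_(xp in Phi) \sum_(0 <= k <oo) \sum_(0 <= j <oo)
    (cell_weight B beta k)%:E * (\1_(cell k j) xp)%:E)%E); last first.
  apply: le_trans (esum_nneseries_le _ _) _.
    by move=> k xp; apply: nneseries_ge0.
  apply: lee_nneseries => [k _ _|k _].
    by apply: esum_ge0 => xp _; exact: nneseries_ge0.
  apply: le_trans (esum_nneseries_le _ _) _ => //.
  apply: lee_nneseries => [j _ _|j _]; first exact: esum_ge0.
  by rewrite -esum_indic_npoints; apply: esumZ_le => [|xp]; rewrite lee_fin.
apply: le_esum => -[x p] Phixp /=; have p0 : 0 < p by exact: (Phi0 _ Phixp).
have sum0 k : (0 <= \sum_(0 <= j <oo)
    (cell_weight B beta k)%:E * (\1_(cell k j) (x, p))%:E)%E by exact: nneseries_ge0.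
have [/fr ->|xr] := leP r (dist2 x z); first by rewrite mule0; exact: nneseries_ge0.
have xs : s <= dist2 x z.
  rewrite leNgt; apply/negP => xs; suff : (Phi `&` near_cell) (x, p) by rewrite Phin.
  split => //; split; rewrite /= ?in_itv /= ?p0 //.
  by apply: dist2_box; rewrite lt_min xs xr.
have [k /andP[k1 k2]] : exists k : nat, 2 ^+ k <= dist2 x z / s < 2 ^+ k.+1.
  by apply: dyadic_bracket; rewrite ler_pdivlMr // mul1r.
rewrite ler_pdivlMr // mulrC in k1; rewrite ltr_pdivrMr // mulrC in k2.
apply: le_trans (ge_nneseries_term k sum0).
rewrite nneseriesZl //.
have [n /andP[pn _] nE] := series_indic_gt p0.
have -> : (\sum_(0 <= j <oo) (\1_(cell k j) (x, p))%:E = n%:R%:E :> \bar R)%E.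
  apply: etrans nE; apply: eq_eseriesr => j _; rewrite !indicE; congr (nat_of_bool _)%:R%:E.
  apply/idP/idP; rewrite !inE; first by case.
  by move=> pj; split => //=; apply: dist2_box; rewrite lt_min k2 xr.
have sk : 0 < s * 2 ^+ k by rewrite mulr_gt0 // exprn_gt0.
rewrite muleC; apply: (@le_trans _ _ ((cell_weight B beta k)%:E * p%:E)%E).
  apply: lee_wpmul2r; first by rewrite lee_fin ltW.
  apply: le_trans (fB _ _) _; first exact: lt_le_trans k1.
  by rewrite lee_fin ler_wpM2l // powRN_le.
by rewrite -!EFinM lee_fin ler_wpM2l.
Qed.

End SiteGeometry.

(** * The excess of a site *)

Lemma nneseries_geometric (R : realType) (a q : R) : 0 <= q < 1 ->
  (\sum_(0 <= k <oo) (a * q ^+ k)%:E = (a / (1 - q))%:E)%E.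
Proof.
move=> /andP[q0 q1]; have q1' : `|q| < 1 by rewrite ger0_norm.
rewrite -(cvg_lim (@Rhausdorff R) (cvg_geometric_series (a := a) q1')).
rewrite -EFin_lim; last exact: is_cvg_geometric_series.
by apply/congr_lim/funext => n /=; rewrite /series /= -sumEFin.
Qed.

(** The series is the mean of the ceiling of a mark. *)
Lemma series_tail_le_mean (R : realType) (F : probability R R) :
  F `]0%R, +oo[%classic = 1%E ->
  (\sum_(0 <= j <oo) F `]j%:R, +oo[%classic <=
   \int[F]_(p in `]0%R, +oo[) p%:E + 1)%E.
Proof.
move=> F1; have mD : measurable (`]0%R, +oo[%classic : set R) by exact: measurable_itv.
have mi j : measurable_fun (`]0%R, +oo[%classic : set R)
    (fun p => (\1_(`]j%:R, +oo[ : set R) p)%:E : \bar R).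
  by apply/measurable_EFinP; apply: measurable_indic; exact: measurable_itv.
rewrite (eq_eseriesr (g := fun j => \int[F]_(p in `]0%R, +oo[)
    (\1_(`]j%:R, +oo[ : set R) p)%:E)%E); last first.
  move=> j _; rewrite integral_indic //.
  congr (F _); apply/esym/setIidPl => x /=; rewrite !in_itv /= !andbT.
  exact: le_lt_trans.
rewrite -integral_nneseries //.
have mp : measurable_fun (`]0%R, +oo[%classic : set R) (fun p => p%:E : \bar R).
  exact/measurable_EFinP.
have <- : (\int[F]_(p in `]0%R, +oo[) cst 1 p = 1)%E.
  by rewrite integral_cst // mul1e; exact: F1.
rewrite -ge0_integralD //; last by move=> p; rewrite /= in_itv /= andbT => /ltW.
apply: ge0_le_integral => //.
- by move=> p _; exact: nneseries_ge0.
- by apply: ge0_emeasurable_sum => // j _.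
- by apply: emeasurable_funD => //; exact: measurable_cst.
- move=> p; rewrite /= in_itv /= andbT => /series_indic_gt[n /andP[_ pn] ->].
  by rewrite -EFinD lee_fin.
Qed.

Lemma intensity_box (R : realType) (lam : R) (F : probability R R) (z : Z2) (q : R)
    (J : set R) : 0 <= q -> measurable J ->
  intensity lam F (box z q `*` J) = ((lam * (2 * q) ^+ 2)%:E * F J)%E.
Proof.
move=> q0 mJ; have leb (a : R) : lebesgue_measure `]a - q, a + q[%classic = (2 * q)%:E.
  rewrite lebesgue_measure_itv /= lte_fin; case: ltP => h; first by rewrite -EFinD; congr EFin; lra.
  by congr EFin; lra.
have boxE : ((@lebesgue_measure R \x @lebesgue_measure R) (box z q) = ((2 * q) ^+ 2)%:E)%E.
  by rewrite /box product_measure1E ?expr2 ?EFinM //; congr (_ * _)%E; exact: leb.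
transitivity (lam%:E * ((@lebesgue_measure R \x @lebesgue_measure R) (box z q) * F J))%E.
  by congr (_ * _)%E; apply: product_measure1E => //; exact: measurable_box.
by rewrite boxE muleA EFinM.
Qed.

Lemma intensity_box_lty (R : realType) (lam : R) (F : probability R R) (z : Z2) (q : R)
    (J : set R) : 0 <= q -> measurable J -> (intensity lam F (box z q `*` J) < +oo)%E.
Proof.
move=> q0 mJ; rewrite intensity_box // ltey_eq; apply/orP; left.
by rewrite fin_numM // fin_num_measure.
Qed.

Lemma adde4_lt1 (R : realType) (a b c e : \bar R) :
  (0 <= a -> 0 <= b -> 0 <= c -> 0 <= e -> a + b + c + e < 1 ->
  [/\ a < 1, b < 1, c < 1 & e < 1])%E.
Proof.
move=> a0 b0 c0 e0 lt1; split; apply: le_lt_trans lt1.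
- by rewrite -!addeA; apply: leeDl; do 2?apply: adde_ge0.
- by rewrite [(a + b)%E]addeC -!addeA; apply: leeDl; do 2?apply: adde_ge0.
- by rewrite [(_ + c)%E]addeC -!addeA; apply: leeDl; do 2?apply: adde_ge0.
- by apply: leeDr; do 2?apply: adde_ge0.
Qed.

Section SiteExcess.
Context (R : realType) (lam : R) (F Lg LW : probability R R).
Context d (T : measurableType d) (P : probability T R).
Variables (Phi : T -> set (@mpoint R)) (g : Z2 -> Z2 -> T -> R) (W : Z2 -> T -> R).
Hypothesis model : marked_model P lam F Lg LW Phi g W.
Variables (L : nat) (r : R).
Hypotheses (L0 : (0 < L)%N) (rL : 2 * r <= L%:R) (r0 : 0 <= r) (lam0 : 0 <= lam).
Variables (s t V B beta : R).
Hypotheses (s0 : 0 < s) (V0 : 0 < V) (B0 : 0 <= B) (beta2 : 2 < beta).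
Local Open Scope ereal_scope.

Notation cylinder := (cylinder lam F Lg LW Phi g W r).
Notation weight k := ((cell_weight s B beta k / V)%:E).

(** Each of the first three terms is at least [1] as soon as its own constraint is violated. Once
    the near cell is empty, the last one bounds the interference divided by [V]. *)
Definition site_excess (z : Z2) (w : T) : \bar R :=
  (\1_(W z @^-1` ~` `[0%R, V]) w)%:E
  + \sum_(i : bool * bool)
      (\1_(g (site_edge z i).1 (site_edge z i).2 @^-1` `]-oo, t]) w)%:E
  + point_count Phi (near_cell s r z) w
  + \sum_(0 <= k <oo) \sum_(0 <= j <oo) (weight k * point_count Phi (cell s r z k j) w).

Definition site_excess_mean (z : Z2) : \bar R :=
  LW (~` `[0%R, V]) + \sum_(i : bool * bool) Lg `]-oo, t]%classic
  + intensity lam F (near_cell s r z)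
  + \sum_(0 <= k <oo) \sum_(0 <= j <oo) (weight k * intensity lam F (cell s r z k j)).

Let weight_ge0 k : 0 <= weight k.
Proof. by rewrite lee_fin divr_ge0 ?(ltW V0) // mulr_ge0 // powR_ge0. Qed.

Let radius_ge0 k : (0 <= Num.min (s * 2 ^+ k) r)%R.
Proof. by rewrite le_min r0 andbT mulr_ge0 ?(ltW s0) // exprn_ge0. Qed.

Let near_radius_ge0 : (0 <= Num.min s r)%R.
Proof. by rewrite le_min r0 andbT (ltW s0). Qed.

Lemma site_excess_indep_mean z :
  indep_mean P (cylinder z) (site_excess z) (site_excess_mean z).
Proof.
apply: indep_meanD; first apply: indep_meanD; first apply: indep_meanD.
- apply: (cylinder_indep_mean model lam0); apply: cylinder_noise => //.
  by apply: measurableC; exact: measurable_itv.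
- apply: indep_mean_sum => i; apply: (cylinder_indep_mean model lam0).
  by apply: cylinder_fading => //; exact: measurable_itv.
- apply: (point_count_indep_mean model L0 rL lam0).
  + exact: measurable_near_cell.
  + exact: near_cell_sub.
  + by apply: intensity_box_lty => //; exact: measurable_itv.
- apply: indep_mean_series => k; apply: indep_mean_series => j.
  apply: indep_meanZ => //; apply: (point_count_indep_mean model L0 rL lam0).
  + exact: measurable_cell.
  + exact: cell_sub.
  + by apply: intensity_box_lty => //; exact: measurable_itv.
Qed.

Lemma site_excess_lt1 (f : R -> \bar R) z w :
  (forall x, (r <= x)%R -> f x = 0) ->
  (forall x, (0 < x)%R -> f x <= (B * x `^ (- beta))%:E) ->
  site_excess z w < 1 ->
  [/\ (0 <= W z w <= V)%R,
      forall i, (t < g (site_edge z i).1 (site_edge z i).2 w)%R &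
      interference f (Phi w) z <= V%:E].
Proof.
move=> fr fB; rewrite /site_excess.
set a := (\1_(_) w)%:E; set b := \sum_(i : bool * bool) _.
set c := point_count _ _ _; set e := \sum_(0 <= k <oo) _.
have a0 : 0 <= a by rewrite lee_fin.
have b0 : 0 <= b by apply: sume_ge0 => i _; rewrite lee_fin.
have c0 : 0 <= c by exact: point_count_ge0.
have e0 : 0 <= e.
  apply: nneseries_ge0 => k _ _; apply: nneseries_ge0 => j _ _.
  by apply: mule_ge0; [exact: weight_ge0|exact: point_count_ge0].
move=> /(adde4_lt1 a0 b0 c0 e0)[a1 b1 c1 e1].
split.
- move: a1; rewrite /a indicE; case: (boolP (w \in _)); first by rewrite ltxx.
  rewrite notin_setE /= => /contrapT; by rewrite in_itv.
- move=> i; rewrite ltNge; apply/negP => gt; move: b1.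
  rewrite /b (bigD1 i) //= indicE mem_set /= ?in_itv //=.
  by rewrite ltNge leeDl //; apply: sume_ge0 => j _; rewrite lee_fin.
- have Phin : Phi w `&` near_cell s r z = set0.
    rewrite -subset0 => xp h; move: (le_lt_trans (npoints_le_point_count _ _ _) c1).
    rewrite ltNge => /negP; apply; rewrite /npoints; apply: esum_ge.
    by exists [set xp]; [split => // _ ->|rewrite fsbig_set1].
  have beta0 : (0 <= beta)%R by apply: ltW; apply: lt_trans beta2.
  have Phi0 : Phi w `<=` [set xp | (0 < xp.2)%R] by case: model.
  apply: le_trans (interference_le s0 beta0 B0 fr fB Phi0 Phin) _.
  rewrite -[leRHS]mule1; apply: le_trans (lee_wpmul2l _ (ltW e1)); last by rewrite lee_fin ltW.
  have n0 k j : 0 <= weight k * point_count Phi (cell s r z k j) w.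
    by apply: mule_ge0; [exact: weight_ge0|exact: point_count_ge0].
  rewrite /e -nneseriesZl; last by move=> k _; exact: nneseries_ge0.
  apply: lee_nneseries => [k _ _|k _].
    apply: nneseries_ge0 => j _ _; rewrite mule_ge0 //; last exact: esum_ge0.
    by rewrite lee_fin mulr_ge0 // powR_ge0.
  rewrite -nneseriesZl //; apply: lee_nneseries => [j _ _|j _].
    rewrite mule_ge0 //; last exact: esum_ge0.
    by rewrite lee_fin mulr_ge0 // powR_ge0.
  rewrite muleA -EFinM mulrCA divff ?gt_eqF // mulr1; apply: lee_wpmul2l.
    by rewrite lee_fin mulr_ge0 // powR_ge0.
  exact: npoints_le_point_count.
Qed.

(** Up to the factor [F] of its mark range, the [k]-th cell has intensity at most
    [lam * (2 * (s * 2 ^+ k.+1)) ^+ 2], that is [16 * lam * s ^+ 2 * 4 ^+ k], and its weight decays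
    like [2 ^+ k] to the power [- beta]. The sum over [k] is therefore geometric, and [SF] bounds
    the sum over mark levels. *)
Lemma site_excess_mean_le (SF : R) z :
  F `]0%R, +oo[%classic = 1 ->
  \sum_(0 <= j <oo) F `]j%:R, +oo[%classic <= SF%:E ->
  site_excess_mean z <= LW (~` `[0%R, V]) + \sum_(i : bool * bool) Lg `]-oo, t]%classic
    + (4 * (lam * s ^+ 2))%:E
    + (16 * B * (s `^ (- beta) * (lam * s ^+ 2)) / V / (1 - 4 * 2 `^ (- beta)) * SF)%:E.
Proof.
move=> F1 FS; pose q := (4 * 2 `^ (- beta) : R)%R.
have q0 : (0 <= q)%R by rewrite mulr_ge0 // powR_ge0.
(* The ratio is [2] to the power [2 - beta]; this is where [beta] exceeding [2] makes the far field
   summable. *)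
have q1 : (q < 1)%R.
  have -> : (q = 2 `^ (2%:R - beta))%R.
    by rewrite powRD ?pnatr_eq0 ?implybT // powR_mulrn // /q; congr (_ * _)%R; lra.
  have b2 : (2%:R - beta < 0)%R by rewrite subr_lt0.
  rewrite /powR pnatr_eq0 /= expR_lt1 (nmulr_rlt0 _ b2).
  by rewrite ln_gt0 // ltr1n.
have sq_min (x y : R) : (0 <= Num.min x y)%R -> (0 <= x)%R ->
    (lam * (2 * Num.min x y) ^+ 2 <= lam * (2 * x) ^+ 2)%R.
  by move=> m0 x0; rewrite ler_wpM2l // lerXn2r ?nnegrE ?mulr_ge0 // ler_wpM2l // ge_min lexx.
apply: leeD; first apply: leeD => //.
  rewrite intensity_box //.
  rewrite F1 mule1 lee_fin; apply: le_trans (sq_min _ _ near_radius_ge0 (ltW s0)) _.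
  by rewrite le_eqVlt; apply/orP; left; apply/eqP; ring.
pose c0 := (16 * B * (s `^ (- beta) * (lam * s ^+ 2)) / V)%R.
have c00 : (0 <= c0)%R.
  by rewrite /c0 divr_ge0 ?(ltW V0) // !mulr_ge0 ?powR_ge0 ?exprn_ge0 ?(ltW s0).
apply: (@le_trans _ _ (\sum_(0 <= k <oo) ((c0 * q ^+ k)%:E * SF%:E))); last first.
  rewrite -nneseriesZr_ge0.
  - by rewrite nneseries_geometric ?q0 // -EFinM lexx.
  - by move=> k; rewrite lee_fin mulr_ge0 // exprn_ge0.
  - by apply: le_trans FS; exact: nneseries_ge0.
apply: lee_nneseries => [k _ _|k _].
  apply: nneseries_ge0 => j _ _; by apply: mule_ge0; [exact: weight_ge0|exact: intensity_ge0].
have ck0 : (0 <= c0 * q ^+ k)%R by rewrite mulr_ge0 // exprn_ge0.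
apply: (@le_trans _ _ (\sum_(0 <= j <oo) ((c0 * q ^+ k)%:E * F `]j%:R, +oo[%classic))); last first.
  by rewrite nneseriesZl //; exact: lee_wpmul2l.
apply: lee_nneseries => [j _ _|j _]; first by
  apply: mule_ge0; [exact: weight_ge0|exact: intensity_ge0].
rewrite intensity_box //.
rewrite muleA; apply: lee_wpmul2r => //; rewrite -EFinM lee_fin.
have s2k : (0 <= s * 2 ^+ k.+1)%R by rewrite mulr_ge0 ?exprn_ge0 // ltW.
apply: le_trans (ler_wpM2l _ (sq_min _ _ (radius_ge0 _) s2k)) _.
  by move: (weight_ge0 k); rewrite lee_fin.
rewrite /cell_weight powRM ?exprn_ge0 ?(ltW s0) //.
have -> : ((2 ^+ k) `^ (- beta) = (2 `^ (- beta)) ^+ k :> R)%R.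
  rewrite -(powR_mulrn k (ler0n R 2)) -(powR_mulrn k (powR_ge0 2 (- beta))).
  by rewrite -!powRrM [(k%:R * _)%R]mulrC.
rewrite /c0 /q [((4 * _) ^+ k)%R]exprMn [(2 ^+ k.+1)%R]exprS le_eqVlt; apply/orP; left.
have -> : (4 ^+ k = 2 ^+ k * 2 ^+ k :> R)%R by rewrite -exprMn; congr (_ ^+ _)%R; ring.
apply/eqP; ring.
Qed.

End SiteExcess.

(** * Peierls argument *)

(** A nonzero multiple of [L] has absolute value at least [L]. *)
Lemma separated_of_residue (L : nat) (z z' : Z2) : (0 < L)%N -> z != z' ->
  (z.1 %% L%:Z)%Z = (z'.1 %% L%:Z)%Z -> (z.2 %% L%:Z)%Z = (z'.2 %% L%:Z)%Z ->
  separated L z z'.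
Proof.
move=> L0 zz' /eqP e1 /eqP e2; rewrite !eqz_mod_dvd in e1 e2.
have far (a : int) : a != 0 -> (L%:Z %| a)%Z -> (L <= `|a|)%N.
  by move=> a0; rewrite dvdzE => /dvdn_leq; apply; rewrite absz_gt0.
rewrite /separated; have [E1|n1] := eqVneq z.1 z'.1; last by rewrite far // subr_eq0.
have [E2|n2] := eqVneq z.2 z'.2; last by rewrite (far (z.2 - z'.2)) ?orbT // subr_eq0.
by move: zz'; rewrite [z]surjective_pairing E1 E2 -surjective_pairing eqxx.
Qed.

(* Pigeonhole on the residues modulo [L]. *)
Lemma separated_subseq (L : nat) (s : seq Z2) : (0 < L)%N -> uniq s ->
  exists s', [/\ subseq s' s, pairwise (separated L) s' & (size s <= size s' * L ^ 2)%N].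
Proof.
case: L => // L _ us.
pose key (z : Z2) : 'I_L.+1 * 'I_L.+1 :=
  (inord `|(z.1 %% L.+1%:Z)%Z|%N, inord `|(z.2 %% L.+1%:Z)%Z|%N).
have key_eq z z' : key z = key z' ->
    (z.1 %% L.+1%:Z)%Z = (z'.1 %% L.+1%:Z)%Z /\ (z.2 %% L.+1%:Z)%Z = (z'.2 %% L.+1%:Z)%Z.
  have res (a b : int) : inord `|(a %% L.+1%:Z)%Z|%N = inord `|(b %% L.+1%:Z)%Z|%N :> 'I_L.+1 ->
      (a %% L.+1%:Z)%Z = (b %% L.+1%:Z)%Z.
    have nn (x : int) : (0 <= (x %% L.+1%:Z)%Z)%R by exact: modz_ge0.
    have lt (x : int) : (`|(x %% L.+1%:Z)%Z| < L.+1)%N.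
      by have := @ltz_pmod x L.+1%:Z isT; have := nn x; lia.
    move=> /(congr1 val); rewrite /= !inordK ?lt // => E.
    by have := nn a; have := nn b; lia.
  by case=> /res -> /res ->.
have [c hc] : exists c : 'I_L.+1 * 'I_L.+1,
    (size s <= count (fun z : Z2 => key z == c) s * L.+1 ^ 2)%N.
  (* Otherwise each of the [L.+1 ^ 2] residue classes is smaller than the average class size,
     contradicting that they partition [s]. *)
  apply: contrapT => /forallNP small.
  have sumE : (\sum_(c : 'I_L.+1 * 'I_L.+1) count (fun z : Z2 => key z == c) s = size s)%N.
    elim: s {us small} => [|z s IH] /=; first by rewrite big1.
    rewrite big_split /= IH (bigD1 (key z)) //= eqxx big1 ?addn0 //.
    by move=> c; rewrite eq_sym => /negbTE ->.
  have : (\sum_(c : 'I_L.+1 * 'I_L.+1) (count (fun z : Z2 => key z == c) s * L.+1 ^ 2) <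
      \sum_(c : 'I_L.+1 * 'I_L.+1) size s)%N.
    rewrite (bigD1 (ord0, ord0)) //= [X in (_ < X)%N](bigD1 (ord0, ord0)) //=.
    rewrite -addSn leq_add //; first by rewrite ltnNge; exact/negP/small.
    by apply: leq_sum => c _; rewrite ltnW // ltnNge; exact/negP/small.
  by rewrite -big_distrl /= sumE sum_nat_const card_prod !card_ord mulnC mulnn ltnn.
exists [seq z <- s | key z == c]; split.
- exact: filter_subseq.
- have := filter_uniq (fun z : Z2 => key z == c) us; rewrite uniq_pairwise.
  apply: sub_in_pairwise => [z z' /= |]; last exact: filter_all.
  move=> /eqP kz /eqP kz' zz'.
  by have [] := key_eq z z' (etrans kz (esym kz')); exact: separated_of_residue.
- by rewrite size_filter.
Qed.

Definition star_nbrs (z : Z2) : seq Z2 :=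
  [seq (z.1 + a, z.2 + b) | a <- [:: -1; 0; 1] : seq int, b <- [:: -1; 0; 1] : seq int].

Fixpoint star_walks (z : Z2) (n : nat) : seq (seq Z2) :=
  if n is m.+1 then [seq v :: p | v <- star_nbrs z, p <- star_walks v m] else [:: [::]].

Lemma star_walksS z n :
  star_walks z n.+1 = [seq v :: p | v <- star_nbrs z, p <- star_walks v n].
Proof. by []. Qed.

Lemma mem_star_nbrs z v : star z v -> v \in star_nbrs z.
Proof.
rewrite /star => zv; apply/allpairsP; exists (v.1 - z.1, v.2 - z.2); split => /=.
- by rewrite !inE; lia.
- by rewrite !inE; lia.
- by rewrite ![_ + (_ - _)]addrC !subrK -surjective_pairing.
Qed.

Lemma mem_star_walks z p : path star z p -> p \in star_walks z (size p).
Proof.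
elim: p z => [|v p IH] z // /andP[zv /IH vp]; rewrite star_walksS.
by apply/allpairsPdep; exists v, p; split => //; exact: mem_star_nbrs.
Qed.

(** Nine choices per step, since [star] is reflexive and a walk may stay put. *)
Lemma size_star_walks z n : size (star_walks z n) = (9 ^ n)%N.
Proof.
elim: n z => // n IH z; rewrite star_walksS size_allpairs_dep.
rewrite (eq_map (g := fun=> 9 ^ n)%N); last by move=> v; exact: IH.
by rewrite /star_nbrs /= expnS; lia.
Qed.

Lemma all_size_star_walks z n : all (fun p : seq Z2 => size p == n) (star_walks z n).
Proof.
elim: n z => // n IH z; rewrite star_walksS.
by apply/allP => q /allpairsPdep[v [p [_ /(allP (IH v)) sp ->]]]; rewrite /= eqSS.
Qed.

(** * Union bound over contours *)

Section Percolation.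
Context d (T : measurableType d) (R : realType) (P : probability T R).
Variables (bad : Z2 -> set T) (eta : R).
Hypothesis mbad : forall z, measurable (bad z).
Hypothesis Pbad : forall s, uniq s ->
  (P (\big[setI/setT]_(z <- s) bad z) <= (eta ^+ size s)%:E)%E.

Definition contour_event (i : nat) : set T :=
  \big[setU/set0]_(p <- star_walks (i%:Z, 0) i | uniq ((i%:Z, 0) :: p))
    \big[setI/setT]_(z <- (i%:Z, 0) :: p) bad z.

Lemma measurable_all_bad s : measurable (\big[setI/setT]_(z <- s) bad z).
Proof. by elim/big_ind : _ => // *; exact: measurableI. Qed.

Lemma measurable_contour_event i : measurable (contour_event i).
Proof.
apply: bigsetU_measurable => p _; exact: measurable_all_bad.
Qed.

(** Union bound over at most [9 ^ i] walks, each visiting [i + 1] distinct sites. *)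
Lemma contour_event_le i : 0 <= eta ->
  (P (contour_event i) <= (eta * (9 * eta) ^+ i)%:E)%E.
Proof.
move=> eta0.
have -> : eta * (9 * eta) ^+ i = (9 ^ i)%N%:R * eta ^+ i.+1.
  by rewrite natrX exprMn exprS; ring.
rewrite -(size_star_walks (i%:Z, 0) i) /contour_event.
move: (all_size_star_walks (i%:Z, 0) i).
elim: (star_walks _ _) => [|p l IH] /=; first by rewrite big_nil measure0 mul0r.
move=> /andP[/eqP sp /IH {}IH]; rewrite big_cons -natr1 mulrDl mul1r EFinD.
case: ifP => up; last by apply: le_trans IH _; rewrite leeDl // lee_fin exprn_ge0.
apply: le_trans (measureU2 _ _ _) _.
- exact: measurable_all_bad.
- by apply: bigsetU_measurable => q _; exact: measurable_all_bad.
- by rewrite addeC; apply: leeD => //; have := Pbad (s := (i%:Z, 0) :: p) up; rewrite /= sp.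
Qed.

(** The contour probabilities sum to at most [eta / (1 - 9 * eta)], which is below [1] exactly when
    [10 * eta < 1]. *)
Lemma no_contour_pos : 0 <= eta -> 10 * eta < 1 ->
  exists A, [/\ measurable A, (0 < P A)%E & forall i, A `&` contour_event i = set0].
Proof.
move=> eta0 eta1; have mU : measurable (\bigcup_i contour_event i).
  by apply: bigcupT_measurable => i; exact: measurable_contour_event.
exists (~` \bigcup_i contour_event i); split; first exact: measurableC.
- have : (P (\bigcup_i contour_event i) < 1)%E; last first.
    by rewrite probability_setC // => lt1; rewrite sube_gt0.
  apply: le_lt_trans (generalized_Boole_inequality _ _ _) _ => //.
    by move=> i; exact: measurable_contour_event.
  apply: (@le_lt_trans _ _ (\sum_(0 <= i <oo) (eta * (9 * eta) ^+ i)%:E)%E).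
    by apply: lee_nneseries => // i _; exact: contour_event_le.
  rewrite nneseries_geometric ?lte_fin; last by lra.
  by rewrite ltr_pdivrMr; lra.
- by move=> i; rewrite -subset0 => w [nU Ui]; apply: nU; exists i.
Qed.

End Percolation.

Section GoodCluster.
Variables (good : pred Z2).

Definition good_edge (u v : Z2) : Prop := [/\ nearest u v, good u & good v].

Lemma finite_good_cluster_contour (C : set Z2) : finite_set C ->
  (forall z, clos_refl_trans Z2 good_edge (0, 0) z -> C z) ->
  exists (i : nat) (p : seq Z2),
    [/\ size p = i, path star (i%:Z, 0) p, uniq ((i%:Z, 0) :: p) &
        all (fun z => ~~ good z) ((i%:Z, 0) :: p)].
Proof.
move=> /finite_seqP[s sE] goodC.
(* Goodness is required separately because the empty path reaches the origin even when it is bad. *)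
pose D (z : Z2) := `[< clos_refl_trans Z2 good_edge (0, 0) z >] && good z.
apply: (@finite_cluster_contour good D
  (\max_(z <- s) maxn `|z.1| `|z.2|).+1).
- by move=> g0; rewrite /D g0 andbT; apply/asboolP; exact: rt_refl.
- move=> u v uv /andP[/asboolP Cu gu] gv; rewrite /D gv andbT; apply/asboolP.
  by apply: rt_trans Cu _; exact: rt_step.
- move=> E hE u /andP[/asboolP Cu gu].
  move/(clos_rt_rtn1 Z2 good_edge) : Cu => Cu.
  elim: Cu gu => [//|v w [vw gv gw] Cv IH _]; rewrite -(IH gv) (hE v w) //.
    by rewrite /D gv andbT; apply/asboolP; exact: clos_rtn1_rt.
  rewrite /D gw andbT; apply/asboolP; apply: rt_trans (clos_rtn1_rt _ _ _ _ Cv) _.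
  exact: rt_step.
- move=> u /andP[/asboolP /goodC]; rewrite sE /= => us _.
  have := @leq_bigmax_seq _ s xpredT (fun z : Z2 => maxn `|z.1| `|z.2|)%N u us isT.
  by rewrite geq_max !ltnS => /andP[].
Qed.

End GoodCluster.

(** * Good sites *)

Lemma probability_exhaustion d (T : measurableType d) (R : realType)
    (P : probability T R) (E : (set T)^nat) (e : R) :
  (forall n, measurable (E n)) -> (forall m n, (m <= n)%N -> E m `<=` E n) ->
  P (\bigcup_n E n) = 1%E -> 0 < e -> exists n, (P (~` E n) <= e%:E)%E.
Proof.
move=> mE hE PE e0; apply: contrapT => /forallNP small.
have le1e n : (P (E n) <= (1 - e)%:E)%E.
  move: (small n) => /negP; rewrite -ltNge probability_setC //.
  rewrite -(@fineK _ (P (E n))) ?fin_num_measure // -EFinB lte_fin lee_fin; lra.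
have cv : P (E n) @[n --> \oo] --> P (\bigcup_n E n).
  apply: nondecreasing_cvg_mu => //; first exact: bigcupT_measurable.
  by move=> m n mn; apply/subsetPset; exact: hE.
have : (P (\bigcup_n E n) <= (1 - e)%:E)%E.
  rewrite -(cvg_lim (@ereal_hausdorff R) cv); apply: lime_le; last exact: nearW.
  by apply/cvg_ex; exists (P (\bigcup_n E n)).
by rewrite PE lee_fin; lra.
Qed.

Lemma inve_ge (R : realType) (v q : R) : 0 <= v <= q -> 0 < q ->
  ((q^-1)%:E <= (v%:E)^-1)%E.
Proof.
move=> /andP[v0 vq] q0; rewrite inver; case: eqP => [_|/eqP vn0]; first exact: leey.
by rewrite lee_fin lef_pV2 ?posrE // lt_def vn0.
Qed.

(** The signal is at least [t / b] and the denominator at most [2 * V]. The value [y = 0], whose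
    extended inverse is [+oo], is covered, hence the separate positive bound [b]. *)
Lemma SINR_ge (R : realType) (f : R -> \bar R) (gzz Wz t b V tau y : R) (I : \bar R) :
  f 1 = y%:E -> 0 <= y <= b -> 0 < b -> 0 < t -> t <= gzz -> 0 < V ->
  0 <= Wz <= V -> (0 <= I)%E -> (I <= V%:E)%E -> tau <= t / (b * (2 * V)) ->
  (tau%:E <= SINR f gzz Wz I)%E.
Proof.
move=> f1 yb b0 t0 tg V0 /andP[W0 WV] I0 IV tauE.
have [v vE] : exists v, I = v%:E.
  by exists (fine I); rewrite fineK // ge0_fin_numE //; exact: le_lt_trans IV (ltry _).
rewrite vE in I0 IV *; rewrite !lee_fin in I0 IV; rewrite /SINR f1.
apply: (@le_trans _ _ ((t%:E * (b^-1)%:E) * ((2 * V)^-1)%:E)%E).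
  by rewrite -!EFinM lee_fin; apply: le_trans tauE _; rewrite invfM mulrA.
have h1 : ((b^-1)%:E <= (y%:E)^-1)%E by exact: inve_ge.
have h2 : (((2 * V)^-1)%:E <= (Wz%:E + v%:E)^-1)%E.
  by rewrite -EFinD; apply: inve_ge; [apply/andP; split|]; lra.
apply: lee_pmul => //.
- by rewrite -EFinM lee_fin mulr_ge0 ?invr_ge0 // ltW.
- by rewrite lee_fin invr_ge0; lra.
- by apply: lee_pmul => //; rewrite lee_fin ?invr_ge0 // ltW.
Qed.

Lemma nearestC (u v : Z2) : nearest u v = nearest v u.
Proof. by rewrite /nearest !(distnC u.1) !(distnC u.2). Qed.

Lemma nearest_site_edge (u v : Z2) : nearest u v ->
  exists z i, [/\ z = u \/ z = v & site_edge z i = (u, v)].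
Proof.
case: u => x y; case: v => x' y'; rewrite /nearest /= => uv.
have : [|| (x' == x) && (y' == y + 1), (x' == x) && (y == y' + 1),
         (x' == x + 1) && (y' == y) | (x == x' + 1) && (y' == y)] by lia.
case/or4P => /andP[/eqP -> /eqP ->].
- by exists (x, y), (false, true); split; [left|].
- by exists (x, y'), (false, false); split; [right|].
- by exists (x, y), (true, true); split; [left|].
- by exists (x', y), (true, false); split; [right|].
Qed.

Section GoodSites.
Context (R : realType) (lam : R) (F Lg LW : probability R R).
Context d (T : measurableType d) (P : probability T R).
Variables (Phi : T -> set (@mpoint R)) (g : Z2 -> Z2 -> T -> R) (W : Z2 -> T -> R).
Hypothesis model : marked_model P lam F Lg LW Phi g W.
Variables (L : nat) (r : R).
Hypotheses (L0 : (0 < L)%N) (rL : 2 * r <= L%:R) (r0 : 0 <= r) (lam0 : 0 <= lam).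
Variables (s t V B beta : R).
Hypotheses (s0 : 0 < s) (V0 : 0 < V) (B0 : 0 <= B) (beta2 : 2 < beta).

Notation excess := (site_excess Phi g W r s t V B beta).

Let excess_indep_mean z : indep_mean P (cylinder lam F Lg LW Phi g W r z) (excess z)
  (site_excess_mean lam F Lg LW r s t V B beta z).
Proof. exact: (site_excess_indep_mean model L0 rL). Qed.

Definition bad_site (z : Z2) : set T := [set w | (1 <= excess z w)%E].

Lemma measurable_bad_site z : measurable (bad_site z).
Proof.
rewrite -[X in measurable X]setTI; apply: emeasurable_fun_c_infty => //.
by case: (excess_indep_mean z).
Qed.

(** At least one site in [L ^ 2] can be kept so that the kept ones are pairwise separated; a mean of
    [eta ^+ (L ^ 2)] at each of them pays for a factor [eta] at every original site. *)
Lemma all_bad_le (eta : R) (l : seq Z2) : 0 <= eta <= 1 ->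
  (forall z, (site_excess_mean lam F Lg LW r s t V B beta z <= (eta ^+ (L ^ 2))%:E)%E) ->
  uniq l -> (P (\big[setI/setT]_(z <- l) bad_site z) <= (eta ^+ size l)%:E)%E.
Proof.
move=> /andP[eta0 eta1] mean_le ul; have [l' [ll' sl' szl]] := separated_subseq L0 ul.
have mb (k : seq Z2) : measurable (\big[setI/setT]_(z <- k) bad_site z).
  by apply: measurable_all_bad => z; exact: measurable_bad_site.
apply: (@le_trans _ _ (P (\big[setI/setT]_(z <- l') bad_site z))).
  apply: le_measure; rewrite ?inE // => w.
  rewrite -!bigcap_seq => h z /= zl'; apply: h; exact: mem_subseq zl'.
have -> : \big[setI/setT]_(z <- l') bad_site z =
    \big[setI/setT]_(z <- l') [set w | (1 <= excess z w)%E] by [].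
apply: le_trans (prod_markov (separatedC L) _ _ excess_indep_mean sl') _.
- by move=> z E q; exact: (cylinder_measurable model).
- by move=> k; exact: (cylinder_indep model L0 rL).
apply: (@le_trans _ _ (\prod_(z <- l') (eta ^+ (L ^ 2))%:E)%E).
  elim: l' {ll' sl' szl} => [|z l' IH]; first by rewrite !big_nil.
  rewrite !big_cons; apply: lee_pmul => //; first by case: (excess_indep_mean z).
  by apply: prode_ge0 => y _; case: (excess_indep_mean y).
rewrite prodEFin lee_fin big_const_seq count_predT iter_mulr_1 -exprM.
by apply: ler_wiXn2l => //; rewrite mulnC.
Qed.

(** The fading variable of the oriented edge is charged to one endpoint, which is good, while noise
    and interference are controlled by the goodness of the receiver [v]. *)
Lemma good_edge_conn (f : R -> \bar R) (b tau y : R) (w : T) (u v : Z2) :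
  (forall x, 0 <= x -> (0 <= f x)%E) ->
  (forall x, r <= x -> f x = 0%E) ->
  (forall x, 0 < x -> (f x <= (B * x `^ (- beta))%:E)%E) ->
  f 1 = y%:E -> 0 <= y <= b -> 0 < b -> 0 < t -> tau <= t / (b * (2 * V)) ->
  good_edge (fun z => (excess z w < 1)%E) u v ->
  (tau%:E <= SINR f (g u v w) (W v w) (interference f (Phi w) v))%E.
Proof.
move=> f0 fr fB f1 yb b0 t0 tauE [uv gu gv].
have [z [i [zuv ze]]] := nearest_site_edge uv.
have gz : (excess z w < 1)%E by case: zuv => ->.
have [_ /(_ i) tg _] := site_excess_lt1 model s0 V0 B0 beta2 fr fB gz.
have [Wv _ Iv] := site_excess_lt1 model s0 V0 B0 beta2 fr fB gv.
rewrite ze /= in tg; apply: SINR_ge f1 yb b0 t0 (ltW tg) V0 Wv _ Iv tauE.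
apply: esum_ge0 => -[x p] Phixp; apply: mule_ge0.
  case: model => /(_ w) /(_ _ Phixp) /= p0 _ _ _ _; by rewrite lee_fin ltW.
by apply: f0; rewrite sqrtr_ge0.
Qed.

Lemma infinite_cluster_pos (f : R -> \bar R) (b tau y eta : R) :
  (forall x, 0 <= x -> (0 <= f x)%E) ->
  (forall x, r <= x -> f x = 0%E) ->
  (forall x, 0 < x -> (f x <= (B * x `^ (- beta))%:E)%E) ->
  f 1 = y%:E -> 0 <= y <= b -> 0 < b -> 0 < t -> tau <= t / (b * (2 * V)) ->
  0 <= eta -> 10 * eta < 1 ->
  (forall z, (site_excess_mean lam F Lg LW r s t V B beta z <= (eta ^+ (L ^ 2))%:E)%E) ->
  exists A : set T, measurable A /\
    A `<=` [set w | ~ finite_set (cluster0 (fun z z' =>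
      (tau%:E <= SINR f (g z z' w) (W z' w) (interference f (Phi w) z'))%E))]
    /\ (0 < P A)%E.
Proof.
move=> f0 fr fB f1 yb b0 t0 tauE eta0 eta1 mean_le.
have eta01 : 0 <= eta <= 1 by apply/andP; split => //; lra.
have [A [mA PA noA]] := no_contour_pos measurable_bad_site
  (fun l => all_bad_le eta01 mean_le (l := l)) eta0 eta1.
exists A; split => //; split => // w Aw finC.
(* The supposedly finite cluster contains the cluster of good sites, so a contour of bad sites
   exists, which [A] excludes. *)
have [|i [p [szp stp up badp]]] :=
    @finite_good_cluster_contour (fun z => (excess z w < 1)%E) _ finC.
  move=> z; rewrite /cluster0 /=; elim => [u v gE|u|u v z' _ IH1 _ IH2].
  - apply: rt_step; case: (gE) => uv gu gv.
    have vu : nearest v u by rewrite nearestC.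
    split; first exact: uv.
    have conn_of := good_edge_conn f0 fr fB f1 yb b0 t0 tauE.
    by split; apply: conn_of; [exact: gE|exact: And3 vu gv gu].
  - exact: rt_refl.
  - exact: rt_trans IH1 IH2.
suff : (A `&` contour_event bad_site i) w by rewrite noA.
split => //; rewrite /contour_event -bigcup_seq_cond.
subst i; exists p; first by apply/andP; split; [exact: mem_star_walks|exact: up].
rewrite -bigcap_seq => z /= zp; rewrite /bad_site /= leNgt.
by move/allP: badp => /(_ z zp).
Qed.

End GoodSites.

(** * Choice of the constants *)

Lemma power_law_majorant (R : realType) (beta rho : R) (f : R -> \bar R) :
  0 <= beta -> (forall r, 0 <= r -> (0 <= f r)%E) ->
  (exists M : R, forall r, M <= r -> f r = 0%E) ->
  (forall r, 0 < r <= rho -> f r = (r `^ (- beta))%:E) ->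
  (exists M : R, forall r, rho <= r -> (f r <= M%:E)%E) ->
  exists r B : R, [/\ 0 < r, 0 <= B, forall x, r <= x -> f x = 0%E &
    forall x, 0 < x -> (f x <= (B * x `^ (- beta))%:E)%E].
Proof.
move=> beta0 f0 [M fM] frho [M' fM']; pose r := Num.max M 1.
have r0 : 0 < r by rewrite lt_max ltr01 orbT.
have fr x : r <= x -> f x = 0%E by rewrite ge_max => /andP[/fM].
(* The [1] handles distances up to [rho]. Between [rho] and [r] the bound [M'] is absorbed because
   the power law is at least its value at [r]. *)
exists r, (1 + `|M'| * r `^ beta); split => //.
  by rewrite addr_ge0 // mulr_ge0 // powR_ge0.
move=> x x0; have [xrho|rhox] := leP x rho.
  rewrite frho ?x0 // lee_fin mulrDl mul1r lerDl mulr_ge0 ?powR_ge0 //.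
  by rewrite mulr_ge0 // powR_ge0.
have [/fr ->|xr] := leP r x.
  by rewrite lee_fin mulr_ge0 ?powR_ge0 // addr_ge0 // mulr_ge0 // powR_ge0.
apply: le_trans (fM' _ (ltW rhox)) _; rewrite lee_fin; apply: le_trans (ler_norm _) _.
rewrite mulrDl mul1r; apply: (@le_trans _ _ (`|M'| * r `^ beta * x `^ (- beta))).
  rewrite -mulrA ler_peMr // (@le_trans _ _ (r `^ beta * r `^ (- beta))) //.
    by rewrite powRN divff // gt_eqF // powR_gt0.
  by rewrite ler_wpM2l ?powR_ge0 //; apply: powRN_le => //; exact: ltW.
by rewrite lerDr powR_ge0.
Qed.

Lemma noise_tail (R : realType) (LW : probability R R) (e : R) :
  LW `[0%R, +oo[%classic = 1%E -> 0 < e ->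
  exists n : nat, (LW (~` `[0%R, n%:R]%classic) <= e%:E)%E.
Proof.
move=> LW1 e0; apply: (@probability_exhaustion _ _ _ LW
    (fun n => `[0%R, n%:R]%classic)) => //.
- move=> m n mn x /=; rewrite !in_itv /= => /andP[-> xm] /=.
  by apply: le_trans xm _; rewrite ler_nat.
- rewrite (_ : \bigcup_n _ = `[0%R, +oo[%classic) //; apply/seteqP; split => x /=.
    by move=> [n _ /=]; rewrite !in_itv /= andbT => /andP[].
  rewrite in_itv /= andbT => x0; exists (Num.truncn x).+1 => //=.
  by rewrite in_itv /= x0 ltW // truncnS_gt.
Qed.

Lemma fading_tail (R : realType) (Lg : probability R R) (e : R) :
  Lg `]0%R, +oo[%classic = 1%E -> 0 < e ->
  exists2 t : R, 0 < t & (Lg `]-oo, t]%classic <= e%:E)%E.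
Proof.
move=> Lg1 e0; have [|||n nE] := @probability_exhaustion _ _ _ Lg
    (fun n => `]n.+1%:R^-1, +oo[%classic) e _ _ _ e0.
- by move=> n; exact: measurable_itv.
- move=> m n mn x /=; rewrite !in_itv /= !andbT; apply: le_lt_trans.
  by rewrite lef_pV2 ?posrE // ler_nat.
- rewrite (_ : \bigcup_n _ = `]0%R, +oo[%classic) //; apply/seteqP; split => x /=.
    by move=> [n _ /=]; rewrite !in_itv /= !andbT; apply: lt_trans; rewrite invr_gt0.
  rewrite in_itv /= andbT => x0; exists (Num.truncn x^-1) => //=.
  by rewrite in_itv /= andbT invf_plt ?posrE // truncnS_gt.
exists n.+1%:R^-1; first by rewrite invr_gt0.
by rewrite -setCitvr.
Qed.

Theorem theorem5 (R : realType) (beta rho : R) (f : R -> \bar R)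
    (F Lg LW : probability R R) :
  2 < beta ->
  measurable_fun (`[0%R, +oo[ : set R) f ->
  (forall r, 0 <= r -> (0 <= f r)%E) ->
  (exists M : R, forall r, M <= r -> f r = 0%E) ->
  0 < rho ->
  f 0 = +oo%E ->
  (forall r, 0 < r <= rho -> f r = (r `^ (- beta))%:E) ->
  (exists M : R, forall r, rho <= r -> (f r <= M%:E)%E) ->
  (\int[lebesgue_measure]_(r in `[rho, +oo[) (r%:E * f r) < +oo)%E ->
  F `]0%R, +oo[%classic = 1%E ->
  (\int[F]_(p in `]0%R, +oo[) p%:E < +oo)%E ->
  Lg `]0%R, +oo[%classic = 1%E ->
  LW `[0%R, +oo[%classic = 1%E ->
  exists lam0 c0 : R, 0 < lam0 /\ 0 < c0 /\
    forall lam c : R, lam0 <= lam -> 0 < c <= c0 ->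
    forall d (T : measurableType d) (P : probability T R)
      (Phi : T -> set (@mpoint R)) (g : Z2 -> Z2 -> T -> R) (W : Z2 -> T -> R),
      marked_model P lam F Lg LW Phi g W ->
      let tau := c * lam `^ (- (beta / 2)) in
      let conn w z z' :=
        (tau%:E <= SINR f (g z z' w) (W z' w) (interference f (Phi w) z'))%E in
      exists A : set T, measurable A /\
        A `<=` [set w | ~ finite_set (cluster0 (conn w))] /\ (0 < P A)%E.
Proof.
move=> beta2 _ f0 fM _ _ frho fbnd _ F1 Fmean Lg1 LW1.
have beta0 : 0 <= beta by apply: ltW; apply: lt_trans beta2.
have [r [B [r0 B0 fr fB]]] := power_law_majorant beta0 f0 fM frho fbnd.
have [y fy] : exists y : R, f 1 = y%:E.
  exists (fine (f 1)); rewrite fineK // ge0_fin_numE ?f0 //.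
  by apply: le_lt_trans (fB _ ltr01) _; exact: ltry.
have y0 : 0 <= y by rewrite -lee_fin -fy f0.
pose L := (Num.truncn (2 * r)).+1.
have rL : 2 * r <= L%:R by apply/ltW/truncnS_gt.
(* Any positive [eta] below [1 / 10] suits the Peierls sum. The budget [e] for the mean excess of a
   site is split into four quarters, one per term of [site_excess]. *)
pose eta : R := 1 / 18; pose e : R := eta ^+ (L ^ 2).
have e0 : 0 < e by rewrite exprn_gt0 // /eta; lra.
have [SF FSF] : exists SF : R, (\sum_(0 <= j <oo) F `]j%:R, +oo[%classic <= SF%:E)%E.
  exists (fine (\int[F]_(p in `]0%R, +oo[) p%:E) + 1).
  rewrite EFinD fineK; first exact: series_tail_le_mean.
  rewrite ge0_fin_numE //; apply: integral_ge0 => p; rewrite /= in_itv /= andbT => /ltW.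
  by rewrite lee_fin.
have [n0 noise_le] := noise_tail LW1 (divr_gt0 e0 (ltr0n R 4)).
(* Four fading variables per site, at [e / 16] each. *)
have [t t0 fading_le] := fading_tail Lg1 (divr_gt0 e0 (ltr0n R 16)).
(* Chosen so that the near-cell bound [4 * (lam * s ^+ 2)] equals [e / 4]. *)
pose delta := Num.sqrt (e / 16).
have delta0 : 0 < delta by rewrite sqrtr_gt0 divr_gt0.
have delta2 : delta ^+ 2 = e / 16 by rewrite sqr_sqrtr // ltW // divr_gt0.
pose C1 := 16 * B * (delta `^ (- beta) * delta ^+ 2) / (1 - 4 * 2 `^ (- beta)) * SF.
(* The first summand meets the noise budget, the second the far-field budget, and [1] ensures
   positivity. *)
pose K := n0%:R + 4 * `|C1| / e + 1.
have C1e : 0 <= 4 * `|C1| / e by rewrite divr_ge0 ?(ltW e0) // mulr_ge0.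
have K0 : 0 < K by rewrite /K ltr_wpDl // addr_ge0.
have Kn0 : n0%:R <= K by rewrite /K; lra.
have KC : C1 / K <= e / 4.
  rewrite ler_pdivrMr //; apply: le_trans (ler_norm _) _.
  have -> : `|C1| = e / 4 * (4 * `|C1| / e) by field; rewrite gt_eqF.
  by rewrite ler_wpM2l ?divr_ge0 ?(ltW e0) // /K; have := ler0n R n0; lra.
(* With [lam] at least [1] the bound [V] is at least [K], so the noise budget holds. The bound on
   [c] is the one of [SINR_ge] with [b = y + 1], after the powers of [lam] in [tau] and [V]
   cancel. *)
exists 1, (t / ((y + 1) * (2 * K))); split => //; split.
  by rewrite divr_gt0 // mulr_gt0 ?mulr_gt0 // ltr_wpDl.
move=> lam c lam1 /andP[c0 cle] d T P Phi g W model tau conn.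
have lam0 : 0 < lam by apply: lt_le_trans lam1.
pose Lk := lam `^ (beta / 2); have Lk0 : 0 < Lk by exact: powR_gt0.
have Lk1 : 1 <= Lk by rewrite /Lk -[leLHS](powRr0 lam) ler_powR // divr_ge0.
pose V := K * Lk; have V0 : 0 < V by rewrite mulr_gt0.
have KV : K <= V by rewrite /V ler_peMr // ltW.
(* At this scale [lam * s ^+ 2] does not depend on [lam], and the power law at [s] grows like [Lk],
   which the factor [Lk] of [V] compensates. *)
pose s := delta * lam `^ (- (1 / 2)).
have s0 : 0 < s by rewrite mulr_gt0 // powR_gt0.
have lams : lam * s ^+ 2 = delta ^+ 2.
  rewrite /s exprMn -[X in _ * (_ * X)]powR_mulrn ?powR_ge0 // -powRrM.
  have -> : - (1 / 2) * 2%:R = -1 :> R by field.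
  by rewrite powR_inv1 ?(ltW lam0) // mulrCA divff ?mulr1 // gt_eqF.
have sbeta : s `^ (- beta) = delta `^ (- beta) * Lk.
  rewrite /s powRM ?powR_ge0 ?(ltW delta0) // -powRrM; congr (_ * _ `^ _).
  by field.
have tauE : tau <= t / ((y + 1) * (2 * V)).
  rewrite /tau powRN -/Lk ler_pdivrMr //; apply: le_trans cle _.
  rewrite le_eqVlt; apply/orP; left; apply/eqP; rewrite /V; field.
  by rewrite !gt_eqF //; lra.
apply: (@infinite_cluster_pos _ lam F Lg LW _ _ P Phi g W model L r _ rL (ltW r0) (ltW lam0)
  s t V B beta s0 V0 B0 beta2 f (y + 1) tau y eta) => //; try by rewrite /eta; lra.
move=> z.
apply: le_trans
  (site_excess_mean_le Lg LW (ltW r0) (ltW lam0) t s0 V0 B0 beta2 z F1 FSF) _.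
rewrite lams sbeta.
have -> : 16 * B * (delta `^ (- beta) * Lk * delta ^+ 2) / V
    / (1 - 4 * 2 `^ (- beta)) * SF = C1 / K.
  rewrite /C1 /V invfM; have := divff (lt0r_neq0 Lk0) => Lk'.
  transitivity (Lk / Lk * (16 * B * (delta `^ (- beta) * delta ^+ 2)
    / (1 - 4 * 2 `^ (- beta)) * SF / K)); last by rewrite Lk' mul1r.
  ring.
have -> : eta ^+ (L ^ 2) = e / 4 + e / 4 + e / 4 + e / 4 by rewrite -/e; lra.
rewrite !EFinD; apply: leeD; first apply: leeD; first apply: leeD.
- apply: le_trans noise_le; apply: le_measure; rewrite ?inE.
  + by apply: measurableC; exact: measurable_itv.
  + by apply: measurableC; exact: measurable_itv.
  + apply: subsetC => x /=; rewrite !in_itv /= => /andP[-> xn] /=.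
    by apply: le_trans xn (le_trans Kn0 KV).
- apply: (@le_trans _ _ (\sum_(i : bool * bool) (e / 16)%:E)%E); first exact: lee_sum.
  by rewrite sumEFin lee_fin sumr_const card_prod card_bool -mulr_natr; lra.
- by rewrite lee_fin delta2; lra.
- by rewrite lee_fin.
Qed.
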